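(* For all positive integers $l,s,t$ there are positive integers $f=f(l,s,t)$ and $g=g(t)$ such that for every $t$-tidy graph $G$ that contains an $l$-dense $f$-banana with ends $x,z$, there is an $(s,g)$-dome with root $x$ in $G$.
   Context: Graphs are finite and simple; ''$G$ contains $H$'' means $G$ has an induced subgraph isomorphic to $H$. A path in $G$ is an induced subgraph that is a path. An induced minor of $G$ is obtained from an induced subgraph by repeatedly contracting edges. $G$ is $t$-tidy if $G$ has no induced $K_{t+1}$ and no induced $K_{t,t}$-minor. Two disjoint vertex sets are anticomplete if there is no edge between them. A $q$-banana in $G$ with ends $x,y$ is a pair $(\{x,y\},\mathcal P)$ where $\mathcal P$ is a set of $q$ pairwise internally disjoint $x$–$y$ paths in $G$; $V(\mathcal P)$ is the union of their vertex sets. A $q$-theta with ends $x,y$ is a $q$-banana with ends $x,y$ such that for distinct $P_i,P_j\in\mathcal P$, $P_i\setminus\{x,y\}$ and $P_j\setminus\{x,y\}$ are anticomplete. A banana $(\{x,y\},\mathcal P)$ is $l$-dense if $G[V(\mathcal P)]$ does not contain an $l$-theta with ends $x,y$. A subdivided star is a subdivision of $K_{1,\delta}$ with $\delta\ge3$; its root is its unique vertex of degree at least $3$. An $(s,d)$-dome in $G$ is a pair $(S,P)$ where $S$ is an induced subgraph of $G$ that is a subdivided star with leaf set $L$, $|L|=s$; $P$ is a path in $G$ disjoint from $S$; $V(S)\setminus L$ is anticomplete to $V(P)$; every vertex of $L$ has a neighbor in $P$; every vertex of $P$ is adjacent to at most $d$ vertices of $L$. The root of the dome is the root of $S$.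
   Formalization: The formal theorem takes s ≥ 3 instead of all positive s: a subdivided star has at least three leaves, so no (1,g)- or (2,g)-dome exists, and for s = 1, 2 the claim fails (e.g. in triangle- and theta-free layered wheels with t = 4, l = 3). *)

(* Defs.v *)
From mathcomp Require Import all_boot.

Set Implicit Arguments.
Unset Strict Implicit.
Unset Printing Implicit Defensive.

Record sgraph := SGraph {
  vertex :> finType;
  adj : rel vertex;
  adj_sym : symmetric adj;
  adj_irrefl : irreflexive adj
}.

Notation "x -- y" := (adj x y) (at level 30).

Definition iso (G H : sgraph) : Prop :=
  exists2 h : G -> H, bijective h & forall a b, h a -- h b = a -- b.

Section Induced.
Variables (G : sgraph) (A : {set G}).

Definition induced_adj : rel {x : G | x \in A} := fun a b => val a -- val b.

Lemma induced_sym : symmetric induced_adj.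
Proof. by move=> a b; exact: adj_sym. Qed.

Lemma induced_irrefl : irreflexive induced_adj.
Proof. by move=> a; exact: adj_irrefl. Qed.

Definition induced : sgraph := SGraph induced_sym induced_irrefl.
End Induced.

Definition contains (G H : sgraph) : Prop :=
  exists A : {set G}, iso (induced A) H.

Section Complete.
Variable n : nat.

Definition complete_adj : rel 'I_n := fun i j => i != j.

Lemma complete_sym : symmetric complete_adj.
Proof. by move=> i j; rewrite /complete_adj eq_sym. Qed.

Lemma complete_irrefl : irreflexive complete_adj.
Proof. by move=> i; rewrite /complete_adj eqxx. Qed.

Definition complete : sgraph := SGraph complete_sym complete_irrefl.
End Complete.

Section CompleteBipartite.
Variables m n : nat.

Definition biclique_adj : rel ('I_m + 'I_n)%type := fun a b =>
  match a, b with
  | inl _, inr _ | inr _, inl _ => true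
  | _, _ => false
  end.

Lemma biclique_sym : symmetric biclique_adj.
Proof. by case=> i; case=> j. Qed.

Lemma biclique_irrefl : irreflexive biclique_adj.
Proof. by case. Qed.

Definition biclique : sgraph := SGraph biclique_sym biclique_irrefl.
End CompleteBipartite.

(* [contract u v] deletes [v] and gives its neighbours to [u]; this is the
   contraction of the edge [uv] when [u -- v]. *)
Section Contract.
Variables (G : sgraph) (u v : G).

Definition contract_adj : rel {x : G | x != v} := fun a b =>
  (a != b) && [|| val a -- val b,
                  (val a == u) && (v -- val b) |
                  (val b == u) && (v -- val a)].

Lemma contract_sym : symmetric contract_adj.
Proof.
by move=> a b; rewrite /contract_adj eq_sym (adj_sym (val a));
   congr (_ && (_ || _)); rewrite orbC.
Qed.

Lemma contract_irrefl : irreflexive contract_adj.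
Proof. by move=> a; rewrite /contract_adj eqxx. Qed.

Definition contract : sgraph := SGraph contract_sym contract_irrefl.
End Contract.

Inductive contracts_to : sgraph -> sgraph -> Prop :=
| contracts_iso (G H : sgraph) : iso G H -> contracts_to G H
| contracts_step (G : sgraph) (u v : G) (H : sgraph) :
    u -- v -> contracts_to (contract u v) H -> contracts_to G H.

Definition induced_minor (H G : sgraph) : Prop :=
  exists A : {set G}, contracts_to (induced A) H.

Definition tidy (t : nat) (G : sgraph) : Prop :=
  ~ contains G (complete t.+1) /\ ~ induced_minor (biclique t t) G.

Definition anticomplete (G : sgraph) (A B : {set G}) : Prop :=
  [disjoint A & B] /\ (forall a b, a \in A -> b \in B -> ~~ (a -- b)).

(* A path is an induced subgraph, so it is represented by its vertex set. *)
Definition path_between (G : sgraph) (x y : G) (A : {set G}) : Prop :=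
  exists p : seq G,
    [/\ uniq (x :: p), last x p = y, A = [set a in x :: p] &
        forall i j, i <= size p -> j <= size p ->
          nth x (x :: p) i -- nth x (x :: p) j = (i.+1 == j) || (j.+1 == i)].

Definition is_path (G : sgraph) (A : {set G}) : Prop :=
  exists x y, path_between x y A.

Definition banana (G : sgraph) (q : nat) (x y : G) (P : {set {set G}}) : Prop :=
  [/\ x != y, #|P| = q, forall A, A \in P -> path_between x y A &
      forall A B, A \in P -> B \in P -> A != B ->
        [disjoint A :\: [set x; y] & B :\: [set x; y]]].

Definition theta (G : sgraph) (q : nat) (x y : G) (P : {set {set G}}) : Prop :=
  banana q x y P /\
  (forall A B, A \in P -> B \in P -> A != B ->
     anticomplete (A :\: [set x; y]) (B :\: [set x; y])).

(* The thetas of [G[V(P)]] are the thetas of [G] with all vertices in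
   [V(P) = cover P]. *)
Definition dense (G : sgraph) (l : nat) (x y : G) (P : {set {set G}}) : Prop :=
  ~ exists Q : {set {set G}}, theta l x y Q /\ cover Q \subset cover P.

(* [S] arises from [H] by replacing the edges of [H] with internally disjoint
   paths: [f] places the vertices of [H] and [P u v] is the path replacing the
   edge [uv]. Since [H] is simple, these paths are induced in [S]. *)
Definition subdivision (H S : sgraph) : Prop :=
  exists (f : H -> S) (P : H -> H -> {set S}),
    [/\ injective f,
        forall u v, u -- v -> path_between (f u) (f v) (P u v) /\ P v u = P u v,
        forall u v w, u -- v -> f w \in P u v -> w \in [set u; v] &
        forall u v u' v', u -- v -> u' -- v' -> [set u; v] != [set u'; v'] ->
          P u v :&: P u' v' \subset [set f w | w : H]] /\
    [/\ forall a, a \in [set f w | w : H] \/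
          (exists u v, u -- v /\ a \in P u v) &
        forall a b, a -- b ->
          exists u v, [/\ u -- v, a \in P u v & b \in P u v]].

Definition subdivided_star (S : sgraph) : Prop :=
  exists2 delta, 3 <= delta & subdivision (biclique 1 delta) S.

Definition degree_in (G : sgraph) (S : {set G}) (v : G) : nat :=
  #|[set w in S | v -- w]|.

Definition leaves (G : sgraph) (S : {set G}) : {set G} :=
  [set v in S | degree_in S v == 1].

Definition dome (G : sgraph) (s d : nat) (S P : {set G}) : Prop :=
  [/\ subdivided_star (induced S), #|leaves S| = s, is_path P &
      [disjoint P & S]] /\
  [/\ anticomplete (S :\: leaves S) P,
      forall v, v \in leaves S -> exists2 w, w \in P & v -- w &
      forall w, w \in P -> #|[set v in leaves S | w -- v]| <= d].

Definition star_root (G : sgraph) (S : {set G}) (r : G) : Prop :=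
  r \in S /\ 3 <= degree_in S r.

(* Main.v *)
(* Represent the paths of the banana by their vertex sequences without the ends;
   a prefix of such a sequence is a "leg" from x.  By Ramsey's theorem the first
   vertices of the legs may be assumed to have no neighbour on the other legs:
   otherwise many of them are the leaves of a dome, whose path is another leg
   without its first vertex.  By density, the legs may then be assumed to touch
   (to be joined by an edge) pairwise.

   Cut many legs at their first contact with another leg B.  If for each of many
   choices of B the cut legs are pairwise anticomplete, then they form a star,
   and B without its first vertex is the path of a dome, unless each B has a
   vertex adjacent to the ends of t of the cut legs, the same ones for many B;
   those vertices and these t legs, cut at the last contact, give an induced
   K_{t,t}-minor.  So for some B many of the cut legs still touch pairwise, and
   one can iterate.  This gives a chain B_1, B_2, ... in which B_(i+1) touches
   B_i only with its last vertex, and B_i and B_j are anticomplete for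
   |i - j| >= 2.  Following the chain downwards, from the last vertex of B_(i+1)
   to its last neighbour on B_i and then along B_i to the last vertex of B_i,
   gives a path, and the initial parts of the B_i are the legs of a dome. *)

Require Import Defs.
From mathcomp Require Import all_boot zify.

Set Implicit Arguments.
Unset Strict Implicit.
Unset Printing Implicit Defensive.

(** * Ramsey and pigeonhole for sequences *)

Section SeqRamsey.
Variable T : eqType.
Implicit Types (r : rel T) (s : seq T).

Lemma pairwise_in r s a b : symmetric r -> pairwise r s ->
  a \in s -> b \in s -> a != b -> r a b.
Proof.
move=> rC; elim: s => //= c s IH /andP[/allP rc rs].
rewrite !inE => /predU1P[->|as_] /predU1P[->|bs] //; first by rewrite eqxx.
- by move=> _; apply: rc.
- by move=> _; rewrite rC; apply: rc.
- exact: IH.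
Qed.

(** The Erdos-Szekeres recursion. The argument [k] is fuel that makes it structural; [n + m] units
    suffice, since every recursive step of [ramsey_aux] lowers [n] or [m]. *)
Fixpoint ramsey_number (k n m : nat) : nat :=
  if k is k'.+1 then (ramsey_number k' n.-1 m + ramsey_number k' n m.-1).+1
  else 0.

Lemma ramsey_aux k r n m s : n + m <= k -> ramsey_number k n m <= size s ->
  (exists s', [/\ subseq s' s, size s' = n & pairwise r s']) \/
  (exists s', [/\ subseq s' s, size s' = m & pairwise (fun a b => ~~ r a b) s']).
Proof.
elim: k n m s => [|k IH] [|n] [|m] s //=;
  try by [left; exists [::]; rewrite sub0seq | right; exists [::]; rewrite sub0seq].
rewrite addSn addnS ltnS => lek; case: s => // a s.
have sc p s' : subseq s' [seq b <- s | p b] -> subseq s' (a :: s).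
  move=> ss'; apply: subseq_trans ss' _.
  exact: subseq_trans (filter_subseq _ _) (subseq_cons _ _).
rewrite [size (_ :: _)]/= ltnS => les.
have sz : size s = size [seq b <- s | r a b] + size [seq b <- s | ~~ r a b].
  by rewrite !size_filter count_predC.
have [le1|lt1] := leqP (ramsey_number k n m.+1) (size [seq b <- s | r a b]).
  case: (IH n m.+1 _ _ le1); first by rewrite addnS.
    case=> s' [ss' <- pw]; left; exists (a :: s'); split=> //=.
      by rewrite eqxx; exact: subseq_trans ss' (filter_subseq _ _).
    rewrite pw andbT; apply/allP=> b /(mem_subseq ss').
    by rewrite mem_filter => /andP[].
  case=> s' [ss' <- pw]; right; exists s'; split=> //.
  exact: sc ss'.
have le2 : ramsey_number k n.+1 m <= size [seq b <- s | ~~ r a b].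
  rewrite -(leq_add2l (size [seq b <- s | r a b])) -sz.
  by apply: leq_trans les; rewrite leq_add2r ltnW.
case: (IH n.+1 m _ _ le2) => //.
  case=> s' [ss' <- pw]; left; exists s'; split=> //.
  exact: sc ss'.
case=> s' [ss' <- pw]; right; exists (a :: s'); split=> //=.
  by rewrite eqxx; exact: subseq_trans ss' (filter_subseq _ _).
rewrite pw andbT; apply/allP=> b /(mem_subseq ss').
by rewrite mem_filter => /andP[].
Qed.

(** For each test in [r] the larger of the two classes is kept, at the cost of a factor 2. *)
Lemma pigeonhole (I : eqType) (c : I -> pred T) (r : seq I) n s :
  n * 2 ^ size r <= size s ->
  exists s', [/\ subseq s' s, n <= size s' &
    forall i a b, i \in r -> a \in s' -> b \in s' -> c i a = c i b].
Proof.
elim: r n s => [|i r IH] n s /=; first by rewrite muln1 => les; exists s.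
rewrite expnS mulnA => /IH[s1 [ss1 les1 hom1]].
have : n <= size (filter (c i) s1) \/ n <= size (filter (predC (c i)) s1).
  apply/orP; rewrite -[_ || _]negbK negb_or -!ltnNge; apply/negP=> /andP[l1 l2].
  have := leq_add l1 (ltnW l2); rewrite addSn !size_filter count_predC.
  by rewrite addnn -muln2 ltnNge les1.
case=> len; [exists (filter (c i) s1) | exists (filter (predC (c i)) s1)];
  split=> //; try exact: subseq_trans (filter_subseq _ _) ss1;
  move=> j a b; rewrite inE !mem_filter => /predU1P[->|jr] /andP[pa as1] /andP[pb bs1].
- by rewrite pa pb.
- exact: hom1.
- by rewrite (negbTE pa) (negbTE pb).
- exact: hom1.
Qed.

Lemma seq_max (f : T -> nat) a s : a \in s ->
  exists2 b, b \in s & forall c, c \in s -> f c <= f b.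
Proof.
elim: s a => // c s IH a _; case: s IH => [_|d s /(_ d (mem_head _ _))[b bs hb]].
  by exists c; rewrite ?mem_head // => d; rewrite inE => /eqP->.
have [le|lt] := leqP (f c) (f b).
  by exists b => [|e /predU1P[->|/hb]]; rewrite // inE bs orbT.
exists c; first exact: mem_head.
by move=> e /predU1P[->|/hb h] //; exact: leq_trans h (ltnW lt).
Qed.

End SeqRamsey.

Definition ramsey n m := ramsey_number (n + m) n m.

Lemma ramseyP (T : eqType) (r : rel T) n m (s : seq T) : ramsey n m <= size s ->
  (exists s', [/\ subseq s' s, size s' = n & pairwise r s']) \/
  (exists s', [/\ subseq s' s, size s' = m & pairwise (fun a b => ~~ r a b) s']).
Proof. exact: ramsey_aux. Qed.

(** * Minor models and contractions *)

Section Model.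

(** A minor model of [H] that covers all of [G], written as the map sending each vertex to the index
    of its branch set. Edges between branch sets must lie over edges of [H], because contraction
    deletes no edges. *)
Record model (G H : sgraph) (f : G -> H) : Prop := Model {
  model_surj : forall h, exists a, f a = h;
  model_conn : forall a b, f a = f b ->
    connect (fun u v => (u -- v) && (f u == f v)) a b;
  model_adj : forall a b, f a != f b -> a -- b -> f a -- f b;
  model_edge : forall h k, h -- k -> exists a b, [/\ f a = h, f b = k & a -- b]
}.

(** Induction on the order of [G]. An injective [f] is an isomorphism; otherwise connectedness gives
    an edge inside a fibre, and contracting it leaves a model. *)
Lemma model_contracts_to (G H : sgraph) (f : G -> H) :
  model f -> contracts_to G H.
Proof.
have [n] := ubnP #|G|; elim: n G f => // n IH G f ltn mf.
case: (boolP (injectiveb f)) => [/injectiveP injf|/injectivePn[a [b neab eqf]]].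
  apply: contracts_iso; exists f.
    have [g fK gK] : bijective f; last by exists g.
    apply: inj_card_bij => //; rewrite -(card_image injf) subset_leq_card //.
    by apply/subsetP=> h _; have [a <-] := model_surj mf h; apply: image_f.
  move=> a b; apply/idP/idP => [/(model_edge mf)[c [d [/injf-> /injf-> //]]]|ab].
  apply: (model_adj mf) => //; apply: contraTneq ab => /injf->.
  by rewrite adj_irrefl.
have [u [v [uv fuv]]] : exists u v, u -- v /\ f u = f v.
  have /connectP[[|c p] /= pth eqb] := model_conn mf eqf.
    by rewrite eqb eqxx in neab.
  by case/andP: pth => /andP[ac /eqP eqac] _; exists a, c.
clear a b neab eqf; have neuv : u != v by apply: contraTneq uv => ->; rewrite adj_irrefl.
apply: (contracts_step uv).
pose f' (a : contract u v) : H := f (val a).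
(* [pi] is the quotient map: the default value of [insubd] sends the deleted vertex [v] to [u]. *)
pose pi (w : G) : contract u v := insubd (Sub u neuv : {x | x != v}) w.
have val_pi w : val (pi w) = if w == v then u else w.
  by rewrite /pi val_insubd; case: eqVneq.
have f_pi w : f' (pi w) = f w.
  by rewrite /f' val_pi; case: eqP => // ->.
have piK (a : contract u v) : pi (val a) = a.
  by apply: val_inj; rewrite val_pi (negbTE (valP a)).
have pi_adj a b : a -- b -> pi a != pi b -> pi a -- pi b.
  move=> ab nepi; rewrite /= /contract_adj nepi !val_pi /=.
  have [ea|nea] := eqVneq a v; have [eb|neb] := eqVneq b v.
  - by move: ab; rewrite ea eb adj_irrefl.
  - by rewrite eqxx -ea ab orbT.
  - by rewrite eqxx -eb (adj_sym b a) ab !orbT.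
  - by rewrite ab.
apply: (IH _ f').
  rewrite -ltnS; apply: leq_trans ltn; rewrite ltnS card_sig.
  by apply: proper_card; apply/properP; split; [exact/subsetP | exists v; rewrite ?inE ?eqxx].
split.
- by move=> h; have [a <-] := model_surj mf h; exists (pi a).
(* A walk inside a fibre of [f] is pushed forward along [pi]; a step that [pi] collapses is
   dropped. *)
- move=> a b; rewrite -(piK a) -(piK b) !f_pi => /(model_conn mf)/connectP[p].
  move: (val a) => {}a pth ->; elim: p a pth => //= c p IHp a.
  case/andP=> /andP[ac /eqP eqac] /IHp; apply: connect_trans.
  have [->//|nepi] := eqVneq (pi a) (pi c).
  by apply: connect1; apply/andP; split; [exact: pi_adj | rewrite !f_pi eqac].
- move=> a b ne /andP[_ /or3P[ab|/andP[/eqP ea ab]|/andP[/eqP eb ab]]].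
  + exact: (model_adj mf).
  + by rewrite /f' ea fuv; apply: (model_adj mf) => //; rewrite -fuv -ea.
  + rewrite adj_sym /f' eb fuv; apply: (model_adj mf) => //.
    by rewrite -fuv -eb eq_sym.
- move=> h k hk; have [a [b [ea eb ab]]] := model_edge mf hk.
  exists (pi a), (pi b); rewrite !f_pi; split=> //; apply: pi_adj => //.
  apply: contraTneq hk => eqpi.
  by rewrite -ea -eb -(f_pi a) eqpi f_pi adj_irrefl.
Qed.

End Model.

(** * Induced paths and induced minors *)

Section Paths.
Variable G : sgraph.
Implicit Types (p q s : seq G) (a b x : G).

Lemma adj_neq a b : a -- b -> a != b.
Proof. by apply: contraTneq => ->; rewrite adj_irrefl. Qed.

(** The index condition of [path_between] as a recursion on the list, which is easier to cut and
    glue; [ipath_nthP] shows that they agree. The empty list counts as a path. *)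
Fixpoint ipath s : bool :=
  if s is a :: s' then
    [&& a \notin s',
        (if s' is b :: s'' then (a -- b) && ~~ has (adj a) s'' else true)
      & ipath s']
  else true.

Lemma ipath_uniq s : ipath s -> uniq s.
Proof. by elim: s => //= a s IH /and3P[-> _ /IH]. Qed.

Lemma ipath_cat s p : ipath (s ++ p) -> ipath s /\ ipath p.
Proof.
elim: s => //= a s IH /and3P[]; rewrite mem_cat negb_or => /andP[-> _] /=.
case: s IH => [|b s] IH adj_a /IH[-> ->] //=.
by move: adj_a; rewrite /= has_cat negb_or => /and3P[-> -> _].
Qed.

Lemma ipath_glue s a p : ipath (rcons s a) -> ipath (a :: p) ->
  ~~ has (mem s) p -> ~~ has (fun b => has (adj b) p) s ->
  ipath (rcons s a ++ p).
Proof.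
elim: s => // b s IH /=; rewrite mem_rcons mem_cat mem_rcons.
move=> /and3P[bs adj_b ips] ipa dj; rewrite !negb_or => /andP[bp sp].
have {}IH : ipath (rcons s a ++ p).
  apply: IH => //; apply: contraNN dj => /hasP[c cp cs].
  by apply/hasP; exists c => //; rewrite /= inE [c \in s]cs orbT.
have -> : b \notin p.
  by apply: contraNN dj => bp'; apply/hasP; exists b => //=; exact: mem_head.
move: bs; rewrite IH inE !andbT negb_or => bs; rewrite [X in X && _]bs /= => {IH ips bs}.
case: s adj_b dj sp => [|c s] /=; first by move=> /andP[-> _].
by rewrite has_cat !negb_or => /andP[-> ->].
Qed.

Lemma ipath_nthP s : ipath s <->
  uniq s /\ forall a0 i j, i < size s -> j < size s ->
    nth a0 s i -- nth a0 s j = (i.+1 == j) || (j.+1 == i).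
Proof.
split=> [|[]]; elim: s => //= a s IH.
  case/and3P=> -> adj_a /IH[-> h]; split=> // a0.
  have adj0 j : j < size s -> a -- nth a0 s j = (j == 0).
    case: s adj_a {IH h} => // b s /andP[ab nas]; case: j => //= j lej.
    by apply: contraNF nas => aj; apply/hasP; exists (nth a0 s j); rewrite ?mem_nth.
  case=> [|i] [|j] //=; rewrite ?ltnS ?adj_irrefl ?eqSS //.
  - by move=> _ /adj0->; rewrite orbF eq_sym.
  - by move=> /adj0 h0 _; rewrite adj_sym h0 eq_sym.
  - exact: h.
case/andP=> -> us h; rewrite IH //.
  rewrite andbT; case: s us {IH} h => //= b s _ h.
  have := h a 0 1; rewrite /= => -> //=; apply/hasPn=> c cs.
  have := h a 0 (index c s).+2; rewrite /= nth_index // => -> //.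
  by rewrite !ltnS index_mem.
by move=> a0 i j; have := h a0 i.+1 j.+1; rewrite /= !ltnS !eqSS.
Qed.

Lemma ipath_rev s : ipath s -> ipath (rev s).
Proof.
move=> /ipath_nthP[us h]; apply/ipath_nthP; rewrite rev_uniq; split=> // a0 i j.
rewrite size_rev => ltis ltjs; rewrite !nth_rev // h; last 2 first.
- by rewrite ltn_subrL; case: s ltis {us h ltjs}.
- by rewrite ltn_subrL; case: s ltis {us h ltjs}.
by apply/idP/idP; lia.
Qed.

Definition touch p q := has (fun a => has (adj a) q) p.
Definition disj p q := ~~ has (mem p) q.

Lemma touchP p q : reflect (exists a b, [/\ a \in p, b \in q & a -- b]) (touch p q).
Proof.
apply: (iffP hasP) => [[a ap /hasP[b bq ab]]|[a [b [ap bq ab]]]].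
  by exists a, b.
by exists a => //; apply/hasP; exists b.
Qed.

Lemma touch_sym : symmetric touch.
Proof.
by move=> p q; apply/touchP/touchP=> -[a [b [*]]]; exists b, a; rewrite adj_sym.
Qed.

Lemma touch_sub p q p' q' : {subset p <= p'} -> {subset q <= q'} ->
  touch p q -> touch p' q'.
Proof. by move=> sp sq /touchP[a [b [/sp ? /sq ? ?]]]; apply/touchP; exists a, b. Qed.

Lemma touch1 a q : touch [:: a] q = has (adj a) q.
Proof. by rewrite /touch /= orbF. Qed.

Lemma disjP p q : reflect (forall a, a \in p -> a \in q -> False) (disj p q).
Proof.
apply: (iffP hasPn) => [h a ap /h /negP//|h a aq]; apply/negP=> ap; exact: (h a).
Qed.

Lemma disj_sym : symmetric disj.
Proof. by move=> p q; apply/disjP/disjP=> h a ? ?; exact: (h a). Qed.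

Lemma disj_sub p q p' q' : {subset p <= p'} -> {subset q <= q'} ->
  disj p' q' -> disj p q.
Proof. by move=> sp sq /disjP h; apply/disjP=> a /sp ap /sq; exact: h. Qed.

Lemma disj_uniq (F : seq (seq G)) :
  all (fun p => p != [::]) F -> pairwise disj F -> uniq F.
Proof.
elim: F => //= p F IH /andP[p0 F0] /andP[/allP pF /(IH F0)->]; rewrite andbT.
apply/negP=> /pF; case: p p0 {pF} => // a p _ /disjP/(_ a).
by rewrite mem_head; apply.
Qed.

Definition separated p q := disj p q && ~~ touch p q.

Lemma separated_sym : symmetric separated.
Proof. by move=> p q; rewrite /separated disj_sym touch_sym. Qed.

Lemma separated_sub p q p' q' : {subset p <= p'} -> {subset q <= q'} ->
  separated p' q' -> separated p q.
Proof.
move=> sp sq /andP[dj nt]; rewrite /separated (disj_sub sp sq dj).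
by apply: contraNN nt; exact: touch_sub.
Qed.

(** Used to check [model_conn] on a branch set that is a path. Both directions of [e] are required
    because [connect] is directed. *)
Lemma ipath_connect s (e : rel G) a b : ipath s ->
  (forall u v, u \in s -> v \in s -> u -- v -> e u v && e v u) ->
  a \in s -> b \in s -> connect e a b.
Proof.
elim: s a b => // c s IH a b /= /and3P[_ adj_c ips] h.
have {}IH u v : u \in s -> v \in s -> connect e u v.
  move=> us vs; apply: IH => // u' v' u's v's.
  by apply: h; rewrite inE ?u's ?v's orbT.
have {adj_c} hc u : u \in s -> connect e c u && connect e u c.
  case: s adj_c h IH {ips} => // d s /andP[cd _] h IH us.
  have /andP[ecd edc] : e c d && e d c by apply: h; rewrite ?inE ?eqxx ?orbT.
  apply/andP; split; first by apply: connect_trans (connect1 ecd) (IH _ _ _ us); exact: mem_head.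
  by apply: connect_trans (IH _ _ us _) (connect1 edc); exact: mem_head.
rewrite !inE => /predU1P[->|us] /predU1P[->|vs] //; last exact: IH.
  by case/andP: (hc _ vs).
by case/andP: (hc _ us).
Qed.

Lemma contains_clique n s : size s = n.+1 -> uniq s -> pairwise (@adj G) s ->
  contains G (complete n.+1).
Proof.
move=> szs us pw.
exists [set a in s]; pose h (a : induced [set a in s]) : 'I_n.+1 := inord (index (val a) s).
have hE (a : induced [set a in s]) : h a = index (val a) s :> nat.
  by rewrite inordK // -szs index_mem; have := valP a; rewrite inE.
have hI : injective h.
  move=> a b eqh; apply: val_inj; rewrite -(nth_index (val a) (_ : val a \in s)); last first.
    by have := valP a; rewrite inE.
  by rewrite -hE eqh hE nth_index //; have := valP b; rewrite inE.
exists h.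
  suff [g gK hK] : bijective h by exists g.
  by apply: inj_card_bij => //; rewrite card_ord card_sig -szs -(card_uniqP us) cardsE.
move=> a b; have [eqab|neab] := eqVneq a b.
  by rewrite eqab !adj_irrefl.
rewrite /= /complete_adj (inj_eq hI) neab /induced_adj; apply/esym.
apply: (pairwise_in (@adj_sym G) pw).
- by have := valP a; rewrite inE.
- by have := valP b; rewrite inE.
- by rewrite (inj_eq val_inj).
Qed.

End Paths.

(** Each path of [As] is contracted to a vertex. In the model [g], positions in [U] index the left
    side and positions in [As] the right side. *)
Lemma biclique_minor (G : sgraph) t (U : seq G) (As : seq (seq G)) :
  0 < t -> size U = t -> size As = t -> uniq U -> pairwise (fun a b => ~~ (a -- b)) U ->
  all (fun p => ipath p && (p != [::])) As -> pairwise (@separated G) As ->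
  (forall a p, a \in U -> p \in As -> (a \notin p) && has (adj a) p) ->
  induced_minor (biclique t t) G.
Proof.
case: t => // t _ szU szA uU stU okA sepA touchUA.
pose g w : biclique t.+1 t.+1 :=
  if w \in U then inl (inord (index w U))
  else inr (inord (find (fun p => w \in p) As)).
pose D := [set w | (w \in U) || has (fun p => w \in p) As].
have uA : uniq As.
  apply: disj_uniq (sub_pairwise _ sepA) => [|p q /andP[]//].
  by apply/allP=> p /(allP okA)/andP[].
have gU w : w \in U -> g w = inl (inord (index w U)) by rewrite /g => ->.
have gA w p : p \in As -> w \in p -> g w = inr (inord (index p As)).
  move=> pA wp; rewrite /g ifF; last first.
    by apply/negP=> /touchUA/(_ pA)/andP[/negP].
  do 2!congr (_ _); have hasp : has (fun p => w \in p) As by apply/hasP; exists p.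
  (* The paths are disjoint, so the first one found to contain [w] is [p] itself. *)
  set k := find _ _; have kA : k < size As by rewrite -has_find.
  have wk : w \in nth [::] As k := nth_find [::] hasp.
  apply/eqP; rewrite -(nth_uniq [::] kA _ uA) ?index_mem // nth_index //.
  apply: contraT => ne.
  have /andP[/disjP/(_ w wk wp)//] := pairwise_in (@separated_sym G) sepA (mem_nth _ kA) pA ne.
have DP w : w \in D -> (w \in U) \/ (exists2 p, p \in As & w \in p).
  by rewrite inE => /orP[|/hasP]; [left|right].
have UD w : w \in U -> w \in D by rewrite inE => ->.
have AD w p : p \in As -> w \in p -> w \in D.
  by rewrite inE => pA wp; apply/orP; right; apply/hasP; exists p.
have inj_index (T : eqType) (s : seq T) u v : size s = t.+1 -> u \in s -> v \in s ->
    inord (index u s) = inord (index v s) :> 'I_t.+1 -> u = v.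
  move=> szs us vs /(congr1 val); rewrite /= !inordK -?szs ?index_mem // => eqi.
  by rewrite -(nth_index u us) eqi nth_index.
exists D; apply: (@model_contracts_to (induced D) _ (fun a => g (val a))); split.
- case=> i.
    have iU : i < size U by rewrite szU.
    have x0 : G by case: U iU {szU uU stU touchUA D gU gA g DP UD AD}.
    exists (Sub (nth x0 U i) (UD _ (mem_nth _ iU))); rewrite /= gU ?mem_nth //.
    by rewrite index_uniq // inord_val.
  have iA : i < size As by rewrite szA.
  have /andP[_] := allP okA _ (mem_nth [::] iA).
  case defp: (nth [::] As i) => [//|w p] _.
  have wA : w \in nth [::] As i by rewrite defp mem_head.
  exists (Sub w (AD _ _ (mem_nth _ iA) wA)); rewrite /= (gA _ _ (mem_nth _ iA) wA).
  by rewrite index_uniq // inord_val.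
- move=> a b eqg.
  (* Connectedness is proved among the vertices of [G] lying in [D] and then lifted to the induced
     subgraph. *)
  suff : connect (fun u v => [&& u \in D, v \in D, u -- v & g u == g v]) (val a) (val b).
    case/connectP=> q; elim: q a {eqg} => [|c q IH] a /=.
      by move=> _ eqab; have -> : b = a by exact: val_inj.
    move=> /andP[/and4P[aD cD ac gac] pth] eqb.
    by apply: connect_trans (connect1 _) (IH (Sub c cD) pth eqb); apply/andP.
  case: (DP _ (valP a)) (DP _ (valP b)) => [aU|[p pA ap]] [bU|[q qA bq]].
  + move: eqg; rewrite !gU // => -[/inj_index eqab].
    by have -> : a = b by apply: val_inj; exact: eqab.
  + by move: eqg; rewrite gU // (gA _ q).
  + by move: eqg; rewrite (gA _ p) // gU.
  move: (eqg); rewrite (gA _ p) // (gA _ q) // => -[/inj_index eqpq].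
  have /andP[ipp _] := allP okA _ pA.
  apply: (ipath_connect ipp) => [u v up vp uv|//|]; last by rewrite eqpq.
  by rewrite !(AD _ p) // !(gA _ p) // (adj_sym v) uv eqxx.
- move=> a b; case: (DP _ (valP a)) (DP _ (valP b)) => [aU|[p pA ap]] [bU|[q qA bq]].
  + move=> _ ab; have /negP[] : ~~ (val a -- val b); last exact: ab.
    apply: (pairwise_in _ stU) => //; first by move=> u v; rewrite adj_sym.
    exact: adj_neq ab.
  + by rewrite gU // (gA _ q).
  + by rewrite (gA _ p) // gU.
  rewrite (gA _ p) // (gA _ q) // => ne ab.
  have nepq : p != q by apply: contraNneq ne => ->.
  have /andP[_ /negP[]] := pairwise_in (@separated_sym G) sepA pA qA nepq.
  by apply/touchP; exists (val a), (val b).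
have edge (i j : 'I_t.+1) : exists a b : induced D, [/\ g (val a) = inl i, g (val b) = inr j & a -- b].
  have iU : i < size U by rewrite szU.
  have jA : j < size As by rewrite szA.
  have x0 : G by case: U iU {szU uU stU touchUA D gU gA g DP UD AD}.
  have /andP[_ /hasP[w wp uw]] := touchUA _ _ (mem_nth x0 iU) (mem_nth [::] jA).
  exists (Sub (nth x0 U i) (UD _ (mem_nth _ iU))), (Sub w (AD _ _ (mem_nth _ jA) wp)).
  split=> //=; first by rewrite gU ?mem_nth // index_uniq // inord_val.
  by rewrite (gA _ _ (mem_nth _ jA) wp) index_uniq // inord_val.
case=> i [] j // _.
by have [a [b [ga gb ab]]] := edge j i; exists b, a; split=> //; rewrite adj_sym.
Qed.

(** Tidiness excludes a clique of [t.+1] vertices in [U], so Ramsey leaves [t] pairwise nonadjacent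
    ones, and [biclique_minor] applies. *)
Lemma tidy_biclique (G : sgraph) t (U : seq G) (As : seq (seq G)) :
  0 < t -> tidy t G -> ramsey t.+1 t <= size U -> t <= size As -> uniq U ->
  all (fun p => ipath p && (p != [::])) As -> pairwise (@separated G) As ->
  (forall a p, a \in U -> p \in As -> (a \notin p) && has (adj a) p) ->
  False.
Proof.
move=> t0 [noK noB] leU leA uU ipA sepA h.
case: (ramseyP (@adj G) leU) => [[s [sU sz pw]]|[s [sU sz pw]]].
  by apply: noK; apply: contains_clique sz (subseq_uniq sU uU) pw.
apply: noB; apply: (@biclique_minor G t s (take t As)) => //.
- by rewrite size_take_min; apply/minn_idPl.
- exact: subseq_uniq sU uU.
- by apply/allP=> p /mem_take /(allP ipA).
- exact: subseq_pairwise (take_subseq _ _) sepA.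
- by move=> a p /(mem_subseq sU) aU /mem_take; exact: h.
Qed.

(** * Domes *)

Section PathBetween.
Variable G : sgraph.
Implicit Types (p q s : seq G) (a b x : G).

Lemma path_between_ipath x y (A : {set G}) : path_between x y A <->
  exists p, [/\ ipath (x :: p), last x p = y & A = [set a in x :: p]].
Proof.
split=> -[p].
  case=> up lastp -> h; exists p; split=> //; apply/ipath_nthP; split=> // a0 i j li lj.
  by rewrite !(set_nth_default x a0) // h.
case=> /ipath_nthP[up h] lastp ->; exists p; split=> // i j li lj.
exact: h.
Qed.

Lemma path_between_sym x y (A : {set G}) : path_between x y A -> path_between y x A.
Proof.
move=> /path_between_ipath[p [ip lastp ->]]; apply/path_between_ipath.
move: ip; case/lastP: p lastp => [|p a] lastp ip.
  by rewrite -lastp; exists [::].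
rewrite last_rcons in lastp; exists (rev (x :: p)); split.
- by rewrite -lastp; have := ipath_rev ip; rewrite -rcons_cons rev_rcons.
- by rewrite rev_cons last_rcons.
by apply/setP=> b; rewrite !inE mem_rev mem_rcons !inE lastp orbCA.
Qed.

End PathBetween.

Section Legs.
Variable G : sgraph.
Implicit Types (p q s : seq G) (a b x : G).

Lemma ipath_val (A : {set G}) (s : seq (induced A)) :
  ipath s = @ipath G (map val s).
Proof.
elim: s => //= a s ->; rewrite mem_map; last exact: val_inj.
by case: s => //= b s; rewrite has_map.
Qed.

Lemma lift_seq (A : {set G}) s : {subset s <= A} ->
  exists s' : seq (induced A), map val s' = s.
Proof.
elim: s => [|a s IH] h; first by exists [::].
have aA : a \in A by apply: h; exact: mem_head.
have [|s' <-] := IH; first by move=> b bs; apply: h; rewrite inE bs orbT.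
by exists (Sub a aA :: s').
Qed.

Lemma path_between_induced (A : {set G}) (a b : induced A) p :
  {subset p <= A} -> ipath (val a :: p) -> last (val a) p = val b ->
  path_between a b [set c | val c \in val a :: p].
Proof.
move=> /lift_seq[p' <-] ip lastp; apply/path_between_ipath; exists p'; split.
- by rewrite ipath_val.
- by apply: val_inj; rewrite -lastp last_map.
by apply/setP=> c; rewrite !inE mem_map //; exact: val_inj.
Qed.

Definition init s := if s is a :: s' then belast a s' else [::].

Lemma init_rcons s a : init (rcons s a) = s.
Proof. by case: s => //= b s; rewrite belast_rcons. Qed.

Lemma init_last x s : s != [::] -> s = rcons (init s) (last x s).
Proof. by case/lastP: s => // s a _; rewrite init_rcons last_rcons. Qed.

Lemma mem_init s : {subset init s <= s}.
Proof.
by case/lastP: s => // s a b; rewrite init_rcons mem_rcons inE => ->; rewrite orbT.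
Qed.

Lemma ipath_last_adj s b a : ipath (rcons (rcons s b) a) ->
  (a -- b) && ~~ has (adj a) s.
Proof.
by move/ipath_rev; rewrite !rev_rcons /= has_rev => /and3P[_ /andP[-> ->]].
Qed.

Lemma ipath_mid s1 b a c s2 : ipath (s1 ++ b :: a :: c :: s2) ->
  [/\ a -- b, a -- c & b != c].
Proof.
case/ipath_cat=> _ /= /and3P[]; rewrite !inE !negb_or => /and3P[_ ne _].
by rewrite adj_sym => /andP[-> _] /and3P[_ /andP[-> _] _].
Qed.

(** The root is left out of the sequence so that distinct legs from [x] can be disjoint. *)
Definition leg x p := ipath (x :: p) && (p != [::]).

Lemma leg_notin x p : leg x p -> x \notin p.
Proof. by case/andP=> /and3P[]. Qed.

Lemma leg_head x a p : leg x (a :: p) -> (x -- a) && ~~ has (adj x) p.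
Proof. by case/andP=> /and3P[]. Qed.

Lemma leg_last x p : leg x p -> last x p \in p.
Proof. by case: p => [|a p] /andP[] //= _ _; exact: mem_last. Qed.

End Legs.

Section Dome.
Variables (G : sgraph) (x : G) (L : seq (seq G)) (P : seq G) (d : nat).
Hypotheses (szL : 3 <= size L) (legL : all (leg x) L)
  (sepL : pairwise (@separated G) L).

Definition star_set := [set a | (a == x) || has (fun p => a \in p) L].

Lemma star_setP a : reflect (a = x \/ exists2 p, p \in L & a \in p) (a \in star_set).
Proof.
rewrite inE; apply: (iffP orP) => -[].
- by move/eqP; left.
- by case/hasP=> p; right; exists p.
- by move->; left.
- by case=> p pL ap; right; apply/hasP; exists p.
Qed.

Lemma mem_star_set p a : p \in L -> a \in p -> a \in star_set.
Proof. by move=> pL ap; apply/star_setP; right; exists p. Qed.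

Lemma root_star_set : x \in star_set.
Proof. by apply/star_setP; left. Qed.

Lemma leg_inj p q a : p \in L -> q \in L -> a \in p -> a \in q -> p = q.
Proof.
move=> pL qL ap aq; apply: contraTeq ap => ne; apply/negP=> ap.
have /andP[/disjP h _] := pairwise_in (@separated_sym G) sepL pL qL ne.
exact: h aq.
Qed.

Lemma leg_adj p q a b : p \in L -> q \in L -> a \in p -> b \in q -> a -- b -> p = q.
Proof.
move=> pL qL ap bq; apply: contraTeq => ne; apply/negP=> ab.
have /andP[_ /touchP[]] := pairwise_in (@separated_sym G) sepL pL qL ne.
by exists a, b.
Qed.

Lemma uniq_legs : uniq L.
Proof.
apply: disj_uniq (sub_pairwise _ sepL) => [|p q /andP[]//].
by apply/allP=> p /(allP legL)/andP[].
Qed.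

Lemma uniq_ends : uniq [seq last x p | p <- L].
Proof.
rewrite map_inj_in_uniq ?uniq_legs // => p q pL qL eqpq.
apply: (leg_inj (a := last x p)) => //; first exact: leg_last (allP legL _ pL).
by rewrite eqpq leg_last // (allP legL).
Qed.

(** The first vertices of the legs are distinct neighbours of [x]. *)
Lemma degree_root : 3 <= degree_in star_set x.
Proof.
apply: leq_trans szL _; rewrite -(size_map (head x)).
rewrite /degree_in; set A := [set _ in _ | _].
have uH : uniq [seq head x p | p <- L].
  rewrite map_inj_in_uniq ?uniq_legs // => p q pL qL eqpq.
  have hd r : r \in L -> head x r \in r.
    by move/(allP legL)/andP=> []; case: r => //= a r _ _; exact: mem_head.
  by apply: (leg_inj pL qL (hd p pL)); rewrite eqpq; exact: hd.
rewrite -(card_uniqP uH); apply: subset_leq_card; apply/subsetP=> a /mapP[p pL ->].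
have := allP legL _ pL; case: p pL => [|b p] pL /=; first by rewrite /leg andbF.
by case/leg_head/andP=> xb _; rewrite inE xb andbT (mem_star_set pL) // mem_head.
Qed.

Lemma degree_end p : p \in L -> degree_in star_set (last x p) = 1.
Proof.
move=> pL; have legp := allP legL _ pL; have /andP[ip p0] := legp.
have lp := leg_last legp.
(* The only neighbour is the predecessor on [x :: p], which is [x] if the leg has a single
   vertex. *)
apply/eqP/cards1P; exists (last x (init p)); apply/setP=> w; rewrite !inE.
move: ip; rewrite [in ipath _](init_last x p0) -rcons_cons.
have := lastI x (init p) => /esym eqi; rewrite -eqi => /ipath_last_adj/andP[adjl nadj].
apply/andP/eqP => [[/orP[/eqP ->|/hasP[q qL wq]] aw]|->].
- apply: contraNeq nadj => ne; apply/hasP; exists x => //.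
  by case: (init p) ne => [|b s] //=; rewrite ?eqxx // mem_head.
- have eqq := leg_adj pL qL lp wq aw; rewrite -eqq (init_last x p0) in wq.
  have : w \in x :: init p.
    rewrite mem_rcons inE in wq; case/predU1P: wq => [ew|wi]; last by rewrite inE wi orbT.
    by rewrite ew adj_irrefl in aw.
  rewrite lastI mem_rcons inE => /predU1P[//|wb].
  by case/hasP: nadj; exists w.
split=> //; case ei: (init p) => [|b s] /=; first by rewrite eqxx.
apply/orP; right; apply/hasP; exists p => //; apply: mem_init; rewrite ei.
exact: mem_last.
Qed.

(** The predecessor and the successor on [x :: p] are two distinct neighbours. *)
Lemma degree_init p a : p \in L -> a \in init p -> degree_in star_set a != 1.
Proof.
move=> pL ap; have legp := allP legL _ pL; have /andP[ip p0] := legp.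
have pE := init_last x p0; have [s1 [s2 eqi]] : exists s1 s2, init p = s1 ++ a :: s2.
  by case/splitPr: ap => s1 s2; exists s1, s2.
pose c := head (last x p) s2.
have [s3 eq2] : exists s3, rcons s2 (last x p) = c :: s3.
  by rewrite /c; case: (s2) => [|u s]; [exists [::] | exists (rcons s (last x p))].
have eqp : p = s1 ++ a :: c :: s3 by rewrite pE eqi rcons_cat rcons_cons eq2.
have : ipath (belast x s1 ++ last x s1 :: a :: c :: s3).
  by rewrite -cat_rcons -lastI cat_cons -eqp.
move=> /ipath_mid[ab ac ne].
rewrite neq_ltn; apply/orP; right; rewrite /degree_in.
have -> : 2 = #|[set last x s1; c]| by rewrite cards2 ne.
apply: subset_leq_card; apply/subsetP=> w; rewrite in_set2 => /orP[]/eqP->.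
  rewrite inE ab andbT; case: s1 {ab ne eqi} eqp => [|b s1] eqp; first exact: root_star_set.
  apply: (mem_star_set pL); rewrite eqp mem_cat; apply/orP; left.
  exact: (mem_last b s1).
rewrite inE ac andbT; apply: (mem_star_set pL).
by rewrite eqp mem_cat !inE eqxx !orbT.
Qed.

Lemma leaves_star_set : leaves star_set = [set a in [seq last x p | p <- L]].
Proof.
apply/setP=> a; rewrite in_set {1}/leaves in_set.
apply/andP/mapP => [[/star_setP[->|[p pL ap]] da]|[p pL ->]].
- by have := degree_root; rewrite (eqP da).
- have /andP[_ p0] := allP legL _ pL.
  move: ap; rewrite (init_last x p0) mem_rcons inE => /predU1P[->|ap].
    by exists p.
  by have := degree_init pL ap; rewrite da.
rewrite degree_end //; split=> //.
by apply: (mem_star_set pL); apply: leg_last; exact: (allP legL).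
Qed.

(** The centre of the star is placed at [x], the leaf [i] at the end of leg [i], and each edge is
    replaced by a leg together with [x]. *)
Lemma subdivided_star_set : subdivided_star (induced star_set).
Proof.
exists (size L) => //.
have nthL (i : 'I_(size L)) : nth [::] L i \in L by exact: mem_nth.
have endL (i : 'I_(size L)) : last x (nth [::] L i) \in nth [::] L i.
  by apply: leg_last; exact: (allP legL).
pose S := induced star_set.
pose xS : S := Sub x root_star_set.
pose f (u : biclique 1 (size L)) : S := match u with
  | inl _ => xS
  | inr i => Sub (last x (nth [::] L i)) (mem_star_set (nthL i) (endL i))
  end.
pose Q i := [set a : S | val a \in x :: nth [::] L i].
pose R (u v : biclique 1 (size L)) := match u, v with
  | inl _, inr i | inr i, inl _ => Q i | _, _ => set0 end.
have xnot (i : 'I_(size L)) : x \notin nth [::] L i.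
  exact: leg_notin (allP legL _ (nthL i)).
have injn (i j : 'I_(size L)) : nth [::] L i = nth [::] L j -> i = j.
  by move/eqP; rewrite nth_uniq ?uniq_legs // => /eqP/ord_inj.
have pathQ i : path_between xS (f (inr i)) (Q i).
  apply: path_between_induced => //=.
    by move=> a; exact: mem_star_set.
  by have /andP[] := allP legL _ (nthL i).
have edge (u v : biclique 1 (size L)) : u -- v ->
    exists i, [/\ [set u; v] = [set inl ord0; inr i], R u v = Q i & R v u = Q i].
  case: u v => [u|i] [v|j] // _; rewrite ?(ord1 u) ?(ord1 v); [exists j | exists i]; split=> //.
  by rewrite setUC.
exists f, R; split; split.
- move=> [u|i] [v|j] /(congr1 val) /=; first by rewrite !ord1.
  + by move=> eqx; have := xnot j; rewrite eqx endL.
  + by move=> eqx; have := xnot i; rewrite -eqx endL.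
  by move=> eql; congr inr; apply: injn; apply: (leg_inj (nthL i) (nthL j) (endL i)); rewrite eql.
- case=> [u|i] [v|j] //= _; split=> //; first exact: pathQ.
  by apply: path_between_sym; exact: pathQ.
- move=> u v w /edge[i [-> -> _]]; rewrite !inE; case: w => [w|j] /=.
    by rewrite (ord1 w) eqxx.
  case/predU1P=> [eqx|lj]; first by have := xnot j; rewrite -eqx endL.
  by rewrite (injn j i) ?eqxx ?orbT //; exact: leg_inj (nthL j) (nthL i) (endL j) lj.
- move=> u v u' v' /edge[i [-> -> _]] /edge[j [-> -> _]] ne.
  apply/subsetP=> a; rewrite !inE => /andP[/predU1P[ax _|ai]].
    by apply/imsetP; exists (inl ord0) => //; apply: val_inj.
  case/predU1P=> [ax|aj]; first by apply/imsetP; exists (inl ord0) => //; apply: val_inj.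
  by case/eqP: ne; rewrite (injn i j) //; exact: leg_inj (nthL i) (nthL j) ai aj.
- move=> a; case/star_setP: (valP a) => [ax|[p pL ap]].
    by left; apply/imsetP; exists (inl ord0) => //; apply: val_inj.
  have lp : index p L < size L by rewrite index_mem.
  right; exists (inl ord0), (inr (Ordinal lp)); split=> //=.
  by rewrite inE /= nth_index // inE ap orbT.
move=> a b ab.
have inQ c p (pL : p \in L) : val c \in x :: p ->
    forall lp : index p L < size L, c \in R (inl ord0) (inr (Ordinal lp)).
  by move=> cp lp; rewrite /= inE /= nth_index.
have res p : p \in L -> val a \in x :: p -> val b \in x :: p ->
    exists u v : biclique 1 (size L), [/\ u -- v, a \in R u v & b \in R u v].
  move=> pL ap bp; have lp : index p L < size L by rewrite index_mem.
  by exists (inl ord0), (inr (Ordinal lp)); split=> //; exact: inQ.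
case/star_setP: (valP a) (valP b) => [ax|[p pL ap]] /star_setP[bx|[q qL bq]].
- by have := adj_neq ab; rewrite -(inj_eq val_inj) ax bx eqxx.
- by apply: (res q) => //; rewrite ?ax ?mem_head // inE bq orbT.
- by apply: (res p) => //; rewrite ?bx ?mem_head // inE ap orbT.
apply: (res p) => //; rewrite inE ?ap ?orbT //.
by rewrite (leg_adj pL qL ap bq) ?bq ?orbT.
Qed.

Hypotheses (ipP : ipath P) (P0 : P != [::]) (xP : x \notin P).

(** By [leaves_star_set] the leaves are exactly the last vertices of the legs, so counting legs
    bounds the number of leaves adjacent to [w]. *)
Lemma dome_intro :
  (forall p, p \in L -> [/\ disj p P, ~~ touch (x :: init p) P &
     has (adj (last x p)) P]) ->
  (forall w, w \in P -> count (fun p => w -- last x p) L <= d) ->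
  exists S P : {set G}, dome (size L) d S P /\ star_root S x.
Proof.
move=> legP degP; exists star_set, [set a in P].
have disjPS a : a \in P -> a \notin star_set.
  move=> aP; apply/star_setP=> -[ax|[p /legP[/disjP h _ _] ap]].
    by move: xP; rewrite -ax aP.
  exact: h ap aP.
split; last by split; [exact: root_star_set | exact: degree_root].
split; split.
- exact: subdivided_star_set.
- by rewrite leaves_star_set cardsE (card_uniqP uniq_ends) size_map.
- case: (P) P0 ipP => // a s _ ips; exists a, (last a s); apply/path_between_ipath.
  by exists s.
- rewrite disjoint_subset; apply/subsetP=> a; rewrite !inE => aP.
  by have := disjPS _ aP; rewrite inE.
- split.
    rewrite disjoint_subset; apply/subsetP=> a; rewrite !inE => /andP[_ aS].
    by apply/negP=> /disjPS; rewrite inE aS.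
  move=> a b; rewrite inE leaves_star_set in_set => /andP[nl /star_setP aS].
  move=> bP; apply/negP=> ab.
  have [p0 p0L] : exists p, p \in L by case: (L) szL => // p s _; exists p; exact: mem_head.
  case: aS => [ax|[p pL ap]].
    have [_ /touchP[]] := legP _ p0L; exists a, b; split=> //.
    by rewrite ax mem_head.
  have [_ /touchP[]] := legP _ pL; exists a, b; split=> //.
  have /andP[_ pn0] := allP legL _ pL.
  move: ap; rewrite {1}(init_last x pn0) mem_rcons inE => /predU1P[al|ai].
    by move: nl; rewrite al in_set (map_f (last x)) ?pL.
  by rewrite inE ai orbT.
- move=> v; rewrite leaves_star_set in_set => /mapP[p pL ->].
  by have [_ _ /hasP[w wP vw]] := legP _ pL; exists w; rewrite ?inE.
move=> w; rewrite inE => /degP; apply: leq_trans.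
rewrite leaves_star_set -size_filter -(size_map (last x)).
apply: leq_trans (card_size _); apply: subset_leq_card; apply/subsetP=> v.
rewrite !in_set => /andP[/mapP[p pL ->] wv]; apply/mapP; exists p => //.
by rewrite mem_filter wv.
Qed.

End Dome.

(** * Chains of legs *)

Lemma ramsey_gt0 n m : 0 < n -> 0 < ramsey n m.
Proof. by case: n. Qed.

Section Chain.
Variables (G : sgraph) (x : G).
Implicit Types (p q B : seq G) (c F : seq (seq G)).

Definition clean p q := ~~ touch (take 1 p) q && ~~ touch p (take 1 q).

(** Cleanness is included so that the contact vertices are first neither on [p] nor on [q]: then the
    last vertex of [p] is not adjacent to [x], and [q] has a nonempty part before the contact. *)
Definition hits p q := [&& disj p q, clean p q, ~~ touch (init p) q
  & has (adj (last x p)) q].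

(* The head of the list is the last leg of the chain. *)
Fixpoint chain c := if c is B :: c' then
    [&& leg x B,
        (if c' is B' :: c'' then hits B B' && all (separated B) c'' else true)
      & chain c']
  else true.

Lemma split_last (a : pred G) p : has a p ->
  exists p1 b p2, [/\ p = p1 ++ b :: p2, a b & ~~ has a p2].
Proof.
elim: p => //= b p IH; have [/IH[p1 [c [p2 [-> ac nap]]]] _|nap] := boolP (has a p).
  by exists (b :: p1), c, p2.
by rewrite orbF => ab; exists [::], b, p.
Qed.

Lemma split_first (a : pred G) p : has a p ->
  exists p1 b p2, [/\ p = p1 ++ b :: p2, a b & ~~ has a p1].
Proof.
elim: p => //= b p IH; have [ab _|nab /= /IH[p1 [c [p2 [-> ac nap]]]]] := boolP (a b).
  by exists [::], b, p.
by exists (b :: p1), c, p2; rewrite /= negb_or nab.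
Qed.

Lemma chain_sep B c : chain (B :: c) ->
  (forall a b, a \in B -> b \in flatten c -> a != b) /\
  (forall a b, a \in init B -> b \in flatten c -> ~~ (a -- b)).
Proof.
case: c => [|B' c] /=; first by split.
case/and3P=> _ /andP[/and4P[/disjP dB _ /touchP nt _] /allP sepB] _.
split=> a b aB; rewrite mem_cat => /orP[bB'|/flattenP[p pc bp]].
- by apply: contraTneq bB' => <-; apply/negP; exact: dB.
- by apply: contraTneq bp => <-; have /andP[/disjP h _] := sepB _ pc; apply/negP/h.
- by apply/negP=> ab; case: nt; exists a, b.
apply/negP=> ab; have /andP[_ /touchP[]] := sepB _ pc; exists a, b; split=> //.
exact: mem_init.
Qed.

Lemma chain_x B c : chain (B :: c) -> x \notin flatten (B :: c).
Proof.
elim: c B => [|B' c IH] B.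
  by rewrite /= cats0 andbT => /leg_notin.
move=> /and3P[/leg_notin xB _ /IH xc].
by rewrite [flatten _]/= mem_cat negb_or xB.
Qed.

Lemma ipath_before p1 a p2 b d : ipath (p1 ++ a :: p2) -> b \in p1 -> d \in p2 ->
  ~~ (b -- d) && (b != d).
Proof.
elim: p1 => // c p1 IH /= /and3P[cp adjc ip]; rewrite inE => /predU1P[->|] dp; last exact: IH.
move: cp; rewrite mem_cat inE !negb_or => /and3P[_ _ cp2].
apply/andP; split; last by apply: contraNneq cp2 => ->.
move: adjc; case: p1 {IH ip} => [|u p1] /= /andP[_].
  by move/hasPn; apply.
by rewrite has_cat /= !negb_or => /and3P[_ _ /hasPn]; apply.
Qed.

(** Induction along the chain. [e :: T] is the descending path and [L] the legs cut from [c]. The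
    bound 1 at [e] leaves room for the one leaf that the next link adds next to [e], whence the
    bound 2 on [T]. *)
Lemma chain_dome_aux B c : chain (B :: c) ->
  exists (T : seq G) (L : seq (seq G)), let e := last x B in
  [/\ size L = size c, {subset T <= flatten c}, ipath (e :: T) & ~~ has (adj x) T] /\
  [/\ all (leg x) L, pairwise (@separated G) L,
      forall p, p \in L -> [/\ {subset p <= flatten c}, disj p T,
        (forall a b, a \in x :: init p -> b \in e :: T -> ~~ (a -- b)) & has (adj (last x p)) (e :: T)],
      count (fun p => e -- last x p) L <= 1 &
      forall a, a \in T -> count (fun p => a -- last x p) L <= 2].
Proof.
elim: c B => [|B c IH] B' chB'.
  by exists [::], [::]; split; split=> //=.
have /= /and3P[legB' /andP[hB' /allP sepB'] chB] := chB'.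
have [T [L [[szL subT ipT xT] [legL sepL pL cnt1 cnt2]]]] := IH _ chB.
have [neB ntB] := chain_sep chB; have [neB' ntB'] := chain_sep chB'.
have legB : leg x B by case/and3P: chB.
set e' := last x B' in hB' *; set e := last x B in ipT pL cnt1.
have B0 : B != [::] by case/andP: legB.
have B'0 : B' != [::] by case/andP: legB'.
have e'B' : e' \in B' by exact: leg_last.
have eB : e \in B by exact: leg_last.
case/and4P: hB' => dBB' /andP[/hasPn headB' nheadB] nt'BB' hasB.
(* [w] is the last neighbour of [e'] on [B], so that [e'], [w], [B2] is an induced path, ending at
   [e]; the new leg is taken from [B1]. *)
have [B1 [w [B2 [eqB e'w ne'B2]]]] := split_last hasB.
have e'x : ~~ (x -- e').
  have := legB'; have := init_last x B'0; rewrite -/e'.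
  case eqi : (init B') => [|u v] eqB'.
    by have := headB' e'; rewrite eqB' /= mem_head hasB => /(_ isT).
  by rewrite eqB' rcons_cons => /leg_head/andP[_ /hasPn]; apply; rewrite mem_rcons mem_head.
have B1neq : B1 != [::].
  apply: contraNneq nheadB => B10; apply/touchP; exists e', w.
  by rewrite eqB B10 /= mem_head.
have ipB : ipath B by case/andP: legB => /and3P[].
have lB1 : last x B1 \in B1 by case: (B1) B1neq => //= u v _; exact: mem_last.
have lB1w : last x B1 -- w.
  have := ipB; rewrite eqB; case/lastP: B1 B1neq {eqB lB1} => // u v _.
  by rewrite last_rcons cat_rcons => /ipath_cat[_] /= /and3P[_ /andP[]].
(* The predecessor of [w] is a candidate, so there is a first vertex [v] of [B1] adjacent to [e'] or
   [w]. The new leg ends at [v]; its earlier vertices miss [e'] and [w]. *)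
have : has (fun a => (e' -- a) || (w -- a)) B1.
  by apply/hasP; exists (last x B1) => //; rewrite (adj_sym w) lB1w orbT.
case/split_first=> l1 [v [l2 [eqB1 vP /hasPn nl1]]].
have wB : w \in B by rewrite eqB mem_cat mem_head orbT.
have B1B : {subset B1 <= B} by move=> a aB; rewrite eqB mem_cat aB.
have eE : e = last w B2 by rewrite /e eqB last_cat.
have initB : init B = B1 ++ belast w B2.
  by rewrite eqB lastI -rcons_cat init_rcons.
have B1init : {subset B1 <= init B} by move=> a aB; rewrite initB mem_cat aB.
have vB1 : v \in B1 by rewrite eqB1 mem_cat mem_head orbT.
have vB := B1B _ vB1.
have l1B1 : {subset l1 <= B1} by move=> a al; rewrite eqB1 mem_cat al.
have lB1' : {subset rcons l1 v <= B1}.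
  by move=> a; rewrite mem_rcons inE => /predU1P[->|/l1B1].
have B12 a b : a \in B1 -> b \in B2 -> ~~ (a -- b).
  by move=> aB bB; have /andP[] := ipath_before (etrans (congr1 _ (esym eqB)) ipB) aB bB.
have uB : uniq (B1 ++ w :: B2) by rewrite -eqB ipath_uniq.
have ipw : ipath (w :: B2) by have := ipB; rewrite eqB => /ipath_cat[].
have Tflat : {subset T <= flatten (B :: c)} by move=> a /subT; rewrite /= mem_cat orbC => ->.
have xw : ~~ has (adj x) (w :: B2).
  have := legB; rewrite eqB; case: (B1) B1neq => // u u' _ /leg_head/andP[_].
  by rewrite has_cat negb_or => /andP[].
have initB' a b : a \in B' -> b \in flatten c -> ~~ (a -- b).
  move=> aB' /flattenP[p pc bp]; apply/negP=> ab.
  by have /andP[_ /touchP[]] := sepB' _ pc; exists a, b.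
have memT a : a \in (w :: B2) ++ T -> [\/ a \in belast w B2, a = e | a \in T].
  rewrite mem_cat lastI mem_rcons inE -eE => /orP[/predU1P[]|];
    by [constructor 2|constructor 1|constructor 3].
exists ((w :: B2) ++ T), (rcons l1 v :: L); split; split.
- by rewrite /= szL.
- move=> a; rewrite mem_cat => /orP[aB|/Tflat//].
  by rewrite /= mem_cat eqB mem_cat aB orbT.
- have ipwT : ipath ((w :: B2) ++ T).
    rewrite lastI -eE; apply: ipath_glue => //.
    + by rewrite eE -lastI.
    + apply/hasPn=> a /subT ac; apply/negP=> /= aB.
      have aB' : a \in B by rewrite eqB mem_cat lastI mem_rcons inE aB !orbT.
      by have := neB _ _ aB' ac; rewrite eqxx.
    apply/hasPn=> a aB; apply/hasPn=> b /subT bc.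
    by apply: (ntB a b _ bc); rewrite initB mem_cat aB orbT.
  have e'nin : e' \notin (w :: B2) ++ T.
    apply/negP=> e'in; have /eqP[] : e' != e'; last by [].
    apply: neB' => //; rewrite /= mem_cat.
    move: e'in; rewrite mem_cat => /orP[h|/subT->]; last by rewrite orbT.
    by rewrite eqB mem_cat h orbT.
  apply/and3P; split=> //; rewrite /= e'w has_cat negb_or ne'B2.
  by apply/hasPn=> a /subT; exact: initB'.
- by rewrite has_cat negb_or xw.
- rewrite /= legL andbT; have [ipxB _] := andP legB; apply/andP; split; last by case: (l1).
  by move: ipxB; rewrite eqB eqB1 -(cat_rcons v l1) -catA -cat_cons => /ipath_cat[].
- rewrite /= sepL andbT; apply/allP=> p /pL[pc _ _ _].
  apply/andP; split.
    apply/disjP=> a /lB1' /B1B aB /pc ac.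
    by have := neB _ _ aB ac; rewrite eqxx.
  by apply/touchP=> -[a [b [/lB1'/B1init aB /pc bc ab]]]; have /negP := ntB _ _ aB bc.
- have xT' b : b \in e' :: (w :: B2) ++ T -> ~~ (x -- b).
    rewrite inE => /predU1P[->//|]; rewrite mem_cat => /orP[].
      exact: (hasPn xw).
    exact: (hasPn xT).
  move=> p; rewrite inE => /predU1P[->|pLp].
    split.
    + by move=> a /lB1'/B1B aB; rewrite /= mem_cat aB.
    + apply/disjP=> a /lB1' aB1; rewrite mem_cat => /orP[aB2|/subT aT].
        by move: uB; rewrite cat_uniq => /and3P[_ /hasPn/(_ _ aB2)/negP[]].
      by have := neB _ _ (B1B _ aB1) aT; rewrite eqxx.
    + move=> a b; rewrite init_rcons inE => /predU1P[-> /xT'//|al1].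
      have := nl1 _ al1; rewrite negb_or (adj_sym e') (adj_sym w) => /andP[ae' aw].
      rewrite !inE mem_cat => /or4P[/eqP->//|/eqP->//|bB2|/subT bT].
        exact: (B12 _ _ (l1B1 _ al1) bB2).
      exact: ntB (B1init _ (l1B1 _ al1)) bT.
    by rewrite last_rcons /= !(adj_sym v); case/orP: vP => ->; rewrite ?orbT.
  have [pc /disjP dpT npT hasp] := pL _ pLp; split.
  + by move=> a /pc ac; rewrite /= mem_cat ac orbT.
  + apply/disjP=> a ap; rewrite mem_cat => /orP[aB2|]; last exact: dpT.
    have aB : a \in B by rewrite eqB mem_cat aB2 orbT.
    by have := neB _ _ aB (pc _ ap); rewrite eqxx.
  + move=> a b; rewrite inE => /predU1P[-> /xT'//|ap].
    have ac : a \in flatten c by apply: pc; exact: mem_init.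
    rewrite inE => /predU1P[->|/memT[bB|->|bT]].
    * by rewrite adj_sym; exact: initB'.
    * by rewrite adj_sym; apply: ntB => //; rewrite initB mem_cat bB orbT.
    * by apply: npT; rewrite ?inE ?ap ?eqxx ?orbT.
    * by apply: npT; rewrite ?inE ?ap ?bT ?orbT.
  have [b bT pb] := hasP hasp; apply/orP; right; apply/hasP; exists b => //.
  move: bT; rewrite in_cons mem_cat => /predU1P[->|->]; last by rewrite orbT.
  by rewrite eE mem_last.
(* [B'] is anticomplete to the legs of [c], so [e'] can see only the new leaf [v]. *)
- rewrite /= last_rcons -[X in _ <= X]addn0; apply: leq_add; first exact: leq_b1.
  rewrite leqn0 -leqn0 leqNgt -has_count; apply/hasPn=> p pLp.
  have [pc _ _ _] := pL _ pLp; apply: initB' => //; apply: pc.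
  by apply: leg_last; exact: (allP legL).
move=> a /memT aT; rewrite /= last_rcons.
have lLc p : p \in L -> last x p \in flatten c.
  by move=> pLp; have [pc _ _ _] := pL _ pLp; apply: pc; apply: leg_last; exact: (allP legL).
(* Before [e] only [v] can be seen; [e] may see [v] and one older leaf; vertices of [T] do not see
   [v], because [v] is not the last vertex of [B]. *)
case: aT => [aB|->|aT].
- rewrite -[X in _ <= X]addn1; apply: leq_add; first exact: leq_b1.
  apply: (@leq_trans 0) => //; rewrite leqNgt -has_count; apply/hasPn=> p /lLc pc.
  by apply: ntB => //; rewrite initB mem_cat aB orbT.
- by rewrite -[X in _ <= X]addn1; apply: leq_add; first exact: leq_b1.
have -> : a -- v = false.
  by rewrite adj_sym; apply/negbTE; apply: ntB; [exact: B1init | exact: subT].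
exact: cnt2.
Qed.

Lemma chain_dome c : 3 < size c -> chain c ->
  exists S P : {set G}, dome (size c).-1 2 S P /\ star_root S x.
Proof.
case: c => // B c szc chB.
have [T [L [[szL subT ipT xT] [legL sepL pL cnt1 cnt2]]]] := chain_dome_aux chB.
rewrite /= -szL; have xBc := chain_x chB.
have legB : leg x B by case/and3P: chB.
apply: (dome_intro _ legL sepL ipT) => //.
- by rewrite szL.
- rewrite inE negb_or; apply/andP; split.
    by apply: contraNneq xBc => ->; rewrite /= mem_cat leg_last.
  by apply: contraNN xBc => /subT xc; rewrite /= mem_cat xc orbT.
- move=> p pLp; have [pc /disjP dpT npT hasp] := pL _ pLp; split=> //.
    apply/disjP=> a ap; rewrite inE => /predU1P[ae|]; last exact: dpT.
    have [neB _] := chain_sep chB.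
    by have := neB _ _ (leg_last legB) (pc _ ap); rewrite -ae eqxx.
  by apply/touchP=> -[a [b [ap bT ab]]]; have /negP := npT _ _ ap bT.
move=> a; rewrite inE => /predU1P[->|/cnt2//].
exact: leq_trans cnt1 _.
Qed.

End Chain.

(** * Truncated legs *)

Lemma pairwise_imp (T : eqType) (r1 r2 r : rel T) (s : seq T) :
  {in s &, forall a b, r1 a b -> r2 a b -> r a b} ->
  pairwise r1 s -> pairwise r2 s -> pairwise r s.
Proof.
move=> h pw1 pw2; apply: (sub_in_pairwise (P := mem s) (r := [rel a b | r1 a b && r2 a b])).
- by move=> a b aS bS /andP[]; exact: h.
- exact/allP.
by rewrite pairwise_relI pw1.
Qed.

Section Truncate.
Variables (G : sgraph) (x : G).
Implicit Types (p q B Q : seq G) (F : seq (seq G)).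

(** The contact vertex is kept. Without a contact [find] returns the length of [Q], and [Q] stays
    whole. *)
Definition trunc B Q := take (find (fun a => has (adj a) B) Q).+1 Q.

Lemma truncP B Q : touch Q B ->
  exists q1 a q2, [/\ Q = q1 ++ a :: q2, trunc B Q = rcons q1 a,
    has (adj a) B & ~~ touch q1 B].
Proof.
rewrite /touch /trunc => hasQ; case/split_first: (hasQ) => q1 [a [q2 [-> aB nq1]]].
exists q1, a, q2; split=> //.
rewrite find_cat (negbTE nq1) /= aB addn0 -cat_rcons -[(size q1).+1](size_rcons q1 a).
exact: take_size_cat.
Qed.

Lemma mem_trunc B Q : {subset trunc B Q <= Q}.
Proof. by move=> a /mem_take. Qed.

(** Prefixes of one sequence are nested, so [dome_of_truncs] can compare cut legs by their
    length. *)
Lemma take_le_sub Q i j : size (take i Q) <= size (take j Q) ->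
  {subset take i Q <= take j Q}.
Proof.
have [le|lt] := leqP i j; first by move=> _ a; rewrite -(take_takel Q le) => /mem_take.
by rewrite !size_take_min => lij a; rewrite [take j Q]take_oversize; [exact: mem_take | lia].
Qed.

Lemma trunc_leg B Q : leg x Q -> touch Q B -> leg x (trunc B Q).
Proof.
move=> /andP[ipQ _] /truncP[q1 [a [q2 [eqQ -> _ _]]]]; apply/andP; split; last by case: q1 {eqQ}.
by move: ipQ; rewrite eqQ -cat_rcons -cat_cons => /ipath_cat[].
Qed.

Lemma take1_trunc B Q : take 1 (trunc B Q) = take 1 Q.
Proof. by rewrite /trunc take_takel. Qed.

Lemma take1_sub Q : {subset take 1 Q <= Q}.
Proof. by move=> a /mem_take. Qed.

Definition good p q := [&& disj p q, clean p q & touch p q].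

Lemma clean_sym : symmetric (@clean G).
Proof. by move=> p q; rewrite /clean andbC (touch_sym p) (touch_sym (take 1 p)). Qed.

Lemma clean_sub p q p' q' : {subset p <= p'} -> {subset q <= q'} ->
  {subset take 1 p <= take 1 p'} -> {subset take 1 q <= take 1 q'} ->
  clean p' q' -> clean p q.
Proof.
move=> sp sq sp1 sq1 /andP[n1 n2]; apply/andP; split.
  by apply: contraNN n1; exact: touch_sub.
by apply: contraNN n2; exact: touch_sub.
Qed.

Lemma uniq_pick (f : seq G -> G) F : pairwise (@disj G) F ->
  {in F, forall p, f p \in p} -> uniq [seq f p | p <- F].
Proof.
move=> dF inf; have F0 : all (fun p => p != [::]) F.
  by apply/allP=> p /inf; case: p.
rewrite map_inj_in_uniq ?(disj_uniq F0 dF) // => p q pF qF eqf.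
apply: contraTeq (inf _ pF) => ne; apply/negP=> fp.
have /disjP/(_ _ fp)[] := pairwise_in (@disj_sym G) dF pF qF ne.
by rewrite eqf; exact: inf.
Qed.

Lemma good_disj F : pairwise good F -> pairwise (@disj G) F.
Proof. by apply: sub_pairwise => p q /and3P[]. Qed.

Lemma touch_last p q : touch p q -> q != [::] -> ~~ touch p (init q) ->
  has (adj (last x q)) p.
Proof.
move=> /touchP[a [b [ap bq ab]]] q0 nt; apply/hasP; exists a => //.
move: bq; rewrite {1}(init_last x q0) mem_rcons inE => /predU1P[<-|bq].
  by rewrite adj_sym.
by case/touchP: nt; exists a, b.
Qed.

(** [t] legs to contract and [ramsey t.+1 t] last vertices for [tidy_biclique], against a clique on
    [t.+1] last vertices. *)
Definition ends_number t := ramsey (t + ramsey t.+1 t) t.+1.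

(* Either many last vertices touch t common legs away from the last vertices of
   these, which gives a K_{t,t}-minor, or t + 1 last vertices form a clique. *)
Lemma no_common_ends t F : 0 < t -> tidy t G -> all (leg x) F ->
  pairwise good F -> pairwise (fun p q => ~~ touch p (init q)) F ->
  ends_number t <= size F -> False.
Proof.
move=> t0 tG legF gF eF; case/(ramseyP (fun p q => touch (init p) [:: last x q])).
  case=> F' [sF sz rF].
  have legF' p : p \in F' -> leg x p by move/(mem_subseq sF)/(allP legF).
  have := subseq_pairwise sF gF; have := subseq_pairwise sF eF.
  move: rF; rewrite -(cat_take_drop t F') !pairwise_cat.
  set F1 := take t F'; set F2 := drop t F'.
  move=> /and3P[r12 _ _] /and3P[_ e1 _] /and3P[g12 g1 g2].
  have F2sz : ramsey t.+1 t <= size F2 by rewrite size_drop sz addKn.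
  have F1sz : t <= size F1 by rewrite size_take_min sz; lia.
  have leg1 p : p \in F1 -> leg x p by move/mem_take/legF'.
  have leg2 p : p \in F2 -> leg x p by move/mem_drop/legF'.
  apply: (@tidy_biclique G t [seq last x p | p <- F2] [seq init p | p <- F1]) => //.
  - by rewrite size_map.
  - by rewrite size_map.
  - by apply: uniq_pick (good_disj g2) _ => p /leg2/leg_last.
  - apply/allP=> _ /mapP[p pF ->]; have /andP[ip p0] := leg1 _ pF.
    have [q qF] : exists q, q \in F2.
      case: (F2) F2sz => [|q ? _]; first by rewrite leqNgt ramsey_gt0.
      by exists q; exact: mem_head.
    apply/andP; split; last by have := allrelP r12 _ _ pF qF; case: (init p).
    move: ip; rewrite {1}(init_last x p0) -cats1 -cat_cons => /ipath_cat[].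
    by case/and3P.
  - rewrite pairwise_map; apply: pairwise_imp g1 e1 => p q _ _ /and3P[dpq _ _] ne /=.
    rewrite /separated (disj_sub (@mem_init _ p) (@mem_init _ q) dpq) /=.
    by apply: contraNN ne; apply: touch_sub => //; exact: mem_init.
  move=> _ _ /mapP[q qF ->] /mapP[p pF ->]; apply/andP; split.
    have /and3P[/disjP dpq _ _] := allrelP g12 _ _ pF qF.
    apply/negP=> /mem_init lp; apply: dpq lp _; exact: leg_last (leg2 _ qF).
  by rewrite -touch1 touch_sym; exact: allrelP r12 _ _ pF qF.
case=> F' [sF sz rF]; have [noK _] := tG; apply: noK.
have gF' := subseq_pairwise sF gF.
have legF' p : p \in F' -> leg x p by move/(mem_subseq sF)/(allP legF).
apply: (@contains_clique G t [seq last x p | p <- F']); rewrite ?size_map //.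
  by apply: uniq_pick (good_disj gF') _ => p /legF'/leg_last.
rewrite pairwise_map.
(* The last vertex of [q] has a neighbour on [p] but none on [init p], hence it is adjacent to the
   last vertex of [p]. *)
apply: (pairwise_imp (r1 := fun p q => has (adj (last x q)) p) _ _ rF).
  move=> p q pF qF /= /hasP[a ap qa]; have /andP[_ p0] := legF' _ pF.
  move: ap; rewrite {1}(init_last x p0) mem_rcons inE => /predU1P[ea _|ap].
    by rewrite adj_sym -ea.
  by case/touchP; exists a, (last x q); rewrite mem_head adj_sym.
apply: pairwise_imp gF' (subseq_pairwise sF eF) => p q pF qF /and3P[_ _ tpq] ne.
by apply: touch_last; rewrite // ; have /andP[] := legF' _ qF.
Qed.

End Truncate.

(** * From the banana to the dome *)

(** Enough vertices for [ramsey t.+1 t] of them to have the same neighbours among [s] leaves. *)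
Definition biclique_number s t := ramsey t.+1 t * 2 ^ s.

(** One Ramsey application for each of the [k] choices of [B]. *)
Fixpoint split_number N M k :=
  if k is k'.+1 then ramsey N (split_number N M k') else M.

(** [k] legs serve as choices of [B] and the others are cut. The exponent [k * k] counts the pairs
    of choices whose cut lengths are compared. *)
Definition step_number s t N :=
  let k := biclique_number s t in
  ramsey (ends_number t) (k + split_number N (s * 2 ^ (k * k)) k).

Fixpoint chain_number s t n :=
  if n is n'.+1 then step_number s t (chain_number s t n') else 0.

Definition clean_number s t N :=
  let m := s + biclique_number s t in ramsey t.+1 (ramsey m (ramsey m N)).

Section Main.
Variables (G : sgraph) (x : G) (s t : nat).
Hypotheses (s3 : 2 < s) (t0 : 0 < t) (tG : tidy t G).
Implicit Types (p q B Q : seq G) (F : seq (seq G)).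

(** The bound [t.+1] serves both kinds of domes: with fewer than [t] leaves seen from each path
    vertex, and with at most 2, as for chains. *)
Definition has_dome := exists S P : {set G}, dome s t.+1 S P /\ star_root S x.

(* If every path had a vertex adjacent to [t] of the [s] leaves, then many of
   these vertices would be adjacent to the same [t] leaves. *)
Lemma dome_of_leaves (L : seq G) F : size L = s -> biclique_number s t <= size F ->
  uniq L -> pairwise (fun a b => ~~ (a -- b)) L -> all (adj x) L ->
  pairwise (@disj G) F ->
  {in F, forall p, [/\ ipath p, p != [::], x \notin p & ~~ has (adj x) p]} ->
  {in L & F, forall a p, (a \notin p) && has (adj a) p} ->
  has_dome.
Proof.
move=> szL szF uL stL xL dF okF tLF.
have sepL (L' : seq G) : uniq L' -> pairwise (fun a b => ~~ (a -- b)) L' ->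
    pairwise (@separated G) [seq [:: a] | a <- L'].
  rewrite uniq_pairwise pairwise_map => uL' stL'.
  apply: pairwise_imp uL' stL' => a b _ _ /= ne nab.
  by rewrite /separated /disj /touch /= inE !orbF eq_sym ne.
pose heavy w := t <= count (adj w) L.
(* A path without a heavy vertex is the path of a dome whose legs are the single vertices of [L]. *)
have [allF|/allPn[p pF nhv]] := boolP (all (has heavy) F); last first.
  have [ipp p0 xp nxp] := okF _ pF.
  have := @dome_intro G x [seq [:: a] | a <- L] p t.+1; rewrite size_map szL.
  apply=> //.
  - apply/allP=> _ /mapP[a aL ->]; rewrite /leg /= inE (allP xL) //= !andbT.
    by apply: contraTneq (allP xL _ aL) => ->; rewrite adj_irrefl.
  - exact: sepL.
  - move=> _ /mapP[a aL ->]; have /andP[ap nap] := tLF _ _ aL pF; split=> //.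
      by apply/disjP=> b; rewrite inE => /eqP-> /(negP ap).
    by apply/touchP=> -[b [c [+ cp bc]]]; rewrite inE => /eqP eb; case/hasP: nxp; exists c; rewrite -?eb.
  move=> w wp; rewrite count_map (eq_count (a2 := adj w)) //.
  by have := hasPn nhv _ wp; rewrite /heavy -ltnNge => /ltnW/leqW.
pose v p := nth x p (find heavy p).
have vp p : p \in F -> v p \in p.
  by move=> pF; apply: mem_nth; rewrite -has_find (allP allF).
have hv p : p \in F -> heavy (v p) by move=> pF; apply: nth_find; exact: (allP allF).
rewrite /biclique_number -szL in szF.
(* Paths are grouped by the neighbourhood in [L] of their chosen heavy vertex. *)
have [F' [sF szF' cst]] := pigeonhole (fun a p => v p -- a) szF.
have inF p : p \in F' -> p \in F by exact: mem_subseq sF _.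
have [p0 p0F] : exists p, p \in F'.
  case: (F') szF' => [|p ? _]; first by rewrite leqNgt ramsey_gt0.
  by exists p; exact: mem_head.
case: (@tidy_biclique G t [seq v p | p <- F'] [seq [:: a] | a <- L & v p0 -- a]) => //.
- by rewrite size_map.
- by rewrite size_map size_filter; apply: hv; exact: inF.
- apply: uniq_pick (subseq_pairwise sF dF) _ => p pF; apply: vp; exact: inF.
- by apply/allP=> _ /mapP[a _ ->].
- by apply: sepL; [rewrite filter_uniq | exact: pairwise_filter].
move=> _ q /mapP[p pF ->] /mapP[a]; rewrite mem_filter => /andP[va aL] ->.
rewrite inE /= orbF (cst _ _ p0) // va andbT.
have /andP[ap _] := tLF _ _ aL (inF _ pF).
by apply: contraNneq ap => <-; exact/vp/inF.
Qed.

(** Ramsey is applied for one [B] after another, stopping at the first [B] for which [N] cut legs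
    touch pairwise. *)
Lemma split_truncs N M Bs F : split_number N M (size Bs) <= size F ->
  (exists B F', [/\ B \in Bs, subseq F' F, size F' = N &
     pairwise (fun p q => touch (trunc B p) (trunc B q)) F']) \/
  (exists F', [/\ subseq F' F, M <= size F' & forall B, B \in Bs ->
     pairwise (fun p q => ~~ touch (trunc B p) (trunc B q)) F']).
Proof.
elim: Bs F => [|B Bs IH] F /=; first by right; exists F.
case/(ramseyP (fun p q => touch (trunc B p) (trunc B q))) => -[F1 [sF1 sz1 pw1]].
  by left; exists B, F1; rewrite mem_head.
case: (IH F1); first by rewrite sz1.
  case=> B' [F2 [B'B sF2 sz2 pw2]]; left; exists B', F2; split=> //.
    by rewrite inE B'B orbT.
  exact: subseq_trans sF2 sF1.
case=> F2 [sF2 sz2 pw2]; right; exists F2; split=> //.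
  exact: subseq_trans sF2 sF1.
by move=> B'; rewrite inE => /predU1P[->|/pw2//]; exact: subseq_pairwise sF2 pw1.
Qed.

(** For each [B] the cut legs form a star, and [behead B] is the path of a dome unless it has a
    vertex adjacent to [t] of their ends. If this fails for every [B], many such vertices share [t]
    legs, which are then cut at the last contact to form a biclique minor. *)
Lemma dome_of_truncs Bs F : size Bs = biclique_number s t ->
  s * 2 ^ (size Bs * size Bs) <= size F ->
  all (leg x) Bs -> all (leg x) F -> pairwise (@disj G) Bs -> pairwise (@disj G) F ->
  {in Bs & F, forall B Q, good B Q} ->
  (forall B, B \in Bs -> pairwise (fun p q => ~~ touch (trunc B p) (trunc B q)) F) ->
  has_dome.
Proof.
move=> szB; rewrite -(size_allpairs pair) => szF legB legF dB dF gBF sepF.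
(* The order of the cut points is made the same on all legs, so that one [B] cuts furthest on each
   of them. *)
have [F1 [sF1 sz1 cst1]] := pigeonhole
  (fun BB Q => size (trunc BB.1 Q) <= size (trunc BB.2 Q)) szF.
have {}cst1 B B' P Q : B \in Bs -> B' \in Bs -> P \in F1 -> Q \in F1 ->
    size (trunc B P) <= size (trunc B' P) -> size (trunc B Q) <= size (trunc B' Q).
  move=> BB BB' PF QF; rewrite (cst1 (B, B') P Q) //.
  by apply/allpairsP; exists (B, B').
pose J := take s F1.
have szJ : size J = s by rewrite size_take_min; exact/minn_idPl.
have sJ : subseq J F by apply: subseq_trans (take_subseq _ _) sF1.
have JF1 Q : Q \in J -> Q \in F1 by exact: mem_take.
have JF Q : Q \in J -> Q \in F by exact: mem_subseq.
have tBF B Q : B \in Bs -> Q \in J -> touch Q B.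
  by move=> BB /JF QF; have /and3P[_ _] := gBF _ _ BB QF; rewrite touch_sym.
have legT B Q : B \in Bs -> Q \in J -> leg x (trunc B Q).
  by move=> BB QJ; apply: trunc_leg (tBF _ _ BB QJ); exact: (allP legF _ (JF _ QJ)).
have sepT B : B \in Bs -> pairwise (@separated G) [seq trunc B Q | Q <- J].
  move=> BB; rewrite pairwise_map.
  apply: pairwise_imp (subseq_pairwise sJ dF) (subseq_pairwise sJ (sepF _ BB)).
  move=> p q _ _ dpq npq; apply/andP; split=> //.
  exact: disj_sub (@mem_trunc _ B p) (@mem_trunc _ B q) dpq.
(* The first vertex of [B] is adjacent to [x] and must be dropped; by cleanness it has no neighbour
   on [Q], so no contact is lost. *)
have endT B Q : B \in Bs -> Q \in J ->
    has (adj (last x (trunc B Q))) (behead B) /\ ~~ touch (x :: init (trunc B Q)) (behead B).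
  move=> BB QJ; have [q1 [a [q2 [eqQ -> aB nq1]]]] := truncP (tBF _ _ BB QJ).
  rewrite last_rcons init_rcons; have /and3P[_ /andP[cl _] _] := gBF _ _ BB (JF _ QJ).
  have := allP legB _ BB; case: B {BB tBF legT sepT sepF} aB nq1 cl => [|b B] aB nq1 cl.
    by rewrite /leg andbF.
  move/leg_head=> /andP[_ nxB]; rewrite /=; split.
    move: aB => /= /orP[ab|//]; case/touchP: cl.
    by exists b, a; rewrite adj_sym eqQ mem_head mem_cat mem_head orbT.
  rewrite /touch /= negb_or nxB /=; apply: contraNN nq1; apply: touch_sub => // c cB.
  by rewrite inE cB orbT.
pose heavy B w := t <= count (fun Q => w -- last x (trunc B Q)) J.
have [allB|/allPn[B BB nhv]] := boolP (all (fun B => has (heavy B) (behead B)) Bs); last first.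
  have := @dome_intro G x [seq trunc B Q | Q <- J] (behead B) t.+1; rewrite size_map szJ.
  have [Q0 Q0J] : exists Q, Q \in J by case: (J) szJ s3 => [<-//|Q ? _ _]; exists Q; exact: mem_head.
  have [tch _] := endT _ _ BB Q0J; have lB := allP legB _ BB.
  apply=> //.
  - by apply/allP=> _ /mapP[Q QJ ->]; exact: legT.
  - exact: sepT.
  - by case/andP: lB; case: (B) => //= b B' /and3P[_ _ /and3P[]].
  - by move: tch; case: (behead B) => //=; rewrite orbF.
  - by apply: contraNN (leg_notin lB); exact: mem_behead.
  - move=> _ /mapP[Q QJ ->]; have [h1 h2] := endT _ _ BB QJ; split=> //.
    have /and3P[+ _ _] := gBF _ _ BB (JF _ QJ); rewrite disj_sym.
    by apply: disj_sub; [exact: mem_trunc | exact: mem_behead].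
  move=> w wB; rewrite count_map; have := hasPn nhv _ wB.
  by rewrite /heavy -ltnNge => /ltnW/leqW.
pose v B := nth x (behead B) (find (heavy B) (behead B)).
have vB B : B \in Bs -> v B \in B.
  by move=> BB; apply: mem_behead; apply: mem_nth; rewrite -has_find (allP allB).
have hv B : B \in Bs -> heavy B (v B) by move=> BB; apply: nth_find; exact: (allP allB).
have : ramsey t.+1 t * 2 ^ size J <= size Bs by rewrite szJ szB.
case/(pigeonhole (fun Q B => v B -- last x (trunc B Q))) => Bs' [sB szB' cst2].
have inB B : B \in Bs' -> B \in Bs by exact: mem_subseq sB _.
have [B0 B0B] : exists B, B \in Bs'.
  case: (Bs') szB' => [|B ? _]; first by rewrite leqNgt ramsey_gt0.
  by exists B; exact: mem_head.
pose T := [seq Q <- J | v B0 -- last x (trunc B0 Q)].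
have szT : t <= size T by rewrite size_filter; apply: hv; exact: inB.
have [Q0] : exists Q, Q \in T.
  case: (T) szT => [|Q ? _]; first by rewrite leqNgt t0.
  by exists Q; exact: mem_head.
have TJ Q : Q \in T -> Q \in J by rewrite mem_filter => /andP[].
(* Legs cut for [B1] are the longest, so they contain the ends of the legs cut for every other [B]
   in [Bs']; they are still pairwise separated. *)
move=> /TJ Q0J; have [B1 B1B maxB1] := seq_max (fun B => size (trunc B Q0)) B0B.
case: (@tidy_biclique G t [seq v B | B <- Bs'] [seq trunc B1 Q | Q <- T]) => //.
- by rewrite size_map.
- by rewrite size_map.
- by apply: uniq_pick (subseq_pairwise sB dB) _ => B BB; exact/vB/inB.
- apply/allP=> _ /mapP[Q QT ->].
  by have /andP[/and3P[_ _ ipT] T0] := legT _ _ (inB _ B1B) (TJ _ QT); apply/andP.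
- apply: subseq_pairwise (sepT _ (inB _ B1B)); apply: map_subseq; exact: filter_subseq.
move=> _ _ /mapP[B BB ->] /mapP[Q QT ->]; apply/andP; split.
  have /and3P[/disjP h _ _] := gBF _ _ (inB _ BB) (JF _ (TJ _ QT)).
  apply/negP=> /mem_trunc; apply: h; exact/vB/inB.
apply/hasP; exists (last x (trunc B Q)); last first.
  by rewrite (cst2 Q B B0) // ?(TJ Q) //; move: QT; rewrite mem_filter => /andP[].
apply: (@take_le_sub _ Q); last exact/leg_last/legT/TJ/QT/inB.
exact: (cst1 B B1 Q0 Q (inB _ BB) (inB _ B1B) (JF1 _ Q0J) (JF1 _ (TJ _ QT)) (maxB1 _ BB)).
Qed.

(** One link of the chain: [B] is the new leg and the legs cut at [B] are the next family. Their
    lying in [init Q] keeps them away from the preceding leg of the chain, which [Q] touches only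
    with its last vertex. *)
Lemma step N F : all (leg x) F -> pairwise (@good G) F -> step_number s t N <= size F ->
  has_dome \/ exists B F', [/\ B \in F, size F' = N, all (leg x) F', pairwise (@good G) F' &
    forall Q', Q' \in F' -> hits x Q' B /\ exists2 Q, Q \in F & {subset Q' <= init Q}].
Proof.
move=> legF gF; rewrite /step_number; set k := biclique_number s t.
(* By [no_common_ends] the first outcome is impossible, so every leg touches all earlier ones before
   its last vertex. *)
case/(ramseyP (fun p q => ~~ touch p (init q))) => -[F1 [sF1 sz1 pw1]].
  case: (@no_common_ends G x t F1) => //; last by rewrite sz1.
  - by apply/allP=> p /(mem_subseq sF1)/(allP legF).
  - exact: subseq_pairwise sF1 gF.
have gF1 := subseq_pairwise sF1 gF.
have legF1 p : p \in F1 -> leg x p by move/(mem_subseq sF1)/(allP legF).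
move: pw1 gF1 legF1; rewrite -(cat_take_drop k F1) !pairwise_cat.
have szB : size (take k F1) = k by rewrite size_take_min sz1; lia.
have szO : size (drop k F1) = split_number N (s * 2 ^ (k * k)) k.
  by rewrite size_drop sz1 addKn.
have sB : {subset take k F1 <= F} by move=> B /mem_take/(mem_subseq sF1).
have sO : {subset drop k F1 <= F} by move=> B /mem_drop/(mem_subseq sF1).
move: szB szO sB sO; set Bs := take k F1; set Os := drop k F1 => szB szO sB sO.
move=> /and3P[/allrelP e12 _ _] /and3P[/allrelP g12 gB gO] legF1.
have legO p : p \in Os -> leg x p by move=> pO; apply: legF1; rewrite mem_cat pO orbT.
have legB p : p \in Bs -> leg x p by move=> pO; apply: legF1; rewrite mem_cat pO.
have := leqnn (size Os); rewrite {1}szO -{3}szB.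
case/split_truncs=> [[B [F' [BB sF' szF' tF']]]|[F' [sF' szF' sepF]]]; last first.
  left; apply: (@dome_of_truncs Bs F') => //.
  - by rewrite szB.
  - exact/allP.
  - by apply/allP=> p /(mem_subseq sF')/legO.
  - exact: good_disj.
  - exact: good_disj (subseq_pairwise sF' gO).
  - by move=> B Q BB /(mem_subseq sF'); exact: g12.
right; exists B, [seq trunc B Q | Q <- F'].
have tQ Q : Q \in F' -> touch Q B.
  by move/(mem_subseq sF')=> QO; have /and3P[_ _] := g12 _ _ BB QO; rewrite touch_sym.
split; [exact: sB | by rewrite size_map | | |].
- apply/allP=> _ /mapP[Q QF ->]; apply: trunc_leg (tQ _ QF).
  exact/legO/(mem_subseq sF').
- rewrite pairwise_map; apply: pairwise_imp (subseq_pairwise sF' gO) tF'.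
  move=> p q _ _ /and3P[dpq cpq _] tpq; apply/and3P; split=> //.
    exact: disj_sub (@mem_trunc _ B p) (@mem_trunc _ B q) dpq.
  by apply: clean_sub cpq => a; rewrite ?take1_trunc //; exact: mem_trunc.
move=> _ /mapP[Q QF ->]; have QO := mem_subseq sF' QF.
have /and3P[dBQ cBQ _] := g12 _ _ BB QO.
have := e12 _ _ BB QO; rewrite negbK touch_sym => tiQ.
have [q1 [a [q2 [eqQ eqT aB nq1]]]] := truncP (tQ _ QF).
split; last first.
  exists Q; first exact: sO.
  (* [init Q] already touches [B], so the cut comes before the last vertex of [Q]. *)
  move=> b; rewrite eqT => bT; move: tiQ; rewrite eqQ.
  case/lastP: q2 {eqQ} => [|q2 c].
    by rewrite cats1 init_rcons (negbTE nq1).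
  by rewrite -rcons_cons -rcons_cat init_rcons -cat_rcons mem_cat bT.
apply/and4P; split.
- by rewrite disj_sym; apply: disj_sub dBQ => //; exact: mem_trunc.
- rewrite clean_sym; apply: clean_sub cBQ => // b; rewrite ?take1_trunc //; exact: mem_trunc.
- by rewrite eqT init_rcons.
- by rewrite eqT last_rcons.
Qed.

Lemma chain_build n B c F : chain x (B :: c) -> all (leg x) F -> pairwise (@good G) F ->
  {in F, forall Q, hits x Q B && all (separated Q) c} -> chain_number s t n <= size F ->
  has_dome \/ exists2 c', chain x c' & size c' = n + (size c).+1.
Proof.
elim: n B c F => [|n IH] B c F chB legF gF hF /=; first by right; exists (B :: c).
move=> szF; case: (step legF gF szF) => [|[B' [F' [BF szF' legF' gF' hF']]]]; first by left.
have chB' : chain x [:: B', B & c].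
  by apply/and3P; split=> //; [exact: (allP legF) | exact: hF].
case: (IH B' (B :: c) F') => //; last 2 first.
- by left.
- by case=> c' chc' szc'; right; exists c'; rewrite // szc' /= addSnnS.
- move=> Q' QF'; have [-> [Q QF sQ]] := hF' _ QF'.
  have /andP[/and4P[dQB _ nt _] /allP sepQ] := hF _ QF.
  have sQ' : {subset Q' <= Q} by move=> a /sQ/mem_init.
  rewrite /=; apply/andP; split.
    rewrite /separated (disj_sub sQ' _ dQB) //.
    by apply: contraNN nt; exact: touch_sub.
  by apply/allP=> p /sepQ; exact: separated_sub.
by rewrite szF'.
Qed.

(** One step starts the chain and [s] more extend it; a chain of [s.+1] legs gives [s] leaves. *)
Lemma dome_of_good F : all (leg x) F -> pairwise (@good G) F ->
  chain_number s t s.+1 <= size F -> has_dome.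
Proof.
move=> legF gF /(step legF gF)[//|[B [F' [BF szF' legF' gF' hF']]]].
have chB : chain x [:: B] by rewrite /= (allP legF).
case: (@chain_build s B [::] F') => // [Q /hF'[-> _]//|| [c chc szc]].
  by rewrite szF'.
have := chain_dome _ chc; rewrite szc addn1 /= => /(_ _)[]; first by lia.
move=> S [P [[[h1 h2 h3 h4] [h5 h6 h7]] rS]]; exists S, P; split=> //; split; split=> //.
by move=> w /h7; move: t0; lia.
Qed.

Lemma take1_leg p : leg x p -> take 1 p = [:: head x p].
Proof. by case: p => [|a [|b p]] // /andP[]. Qed.

(** The first vertices of [F1] are the leaves for [dome_of_leaves]. The legs of [F2] lose their
    first vertices, their only neighbours of [x]. *)
Lemma dome_of_touching_heads F1 F2 : size F1 = s -> biclique_number s t <= size F2 ->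
  all (leg x) F1 -> all (leg x) F2 -> pairwise (@disj G) F1 -> pairwise (@disj G) F2 ->
  pairwise (fun p q => ~~ touch (take 1 p) (take 1 q)) F1 ->
  {in F1 & F2, forall p q, disj p q && touch (take 1 p) (behead q)} ->
  has_dome.
Proof.
move=> sz1 sz2 leg1 leg2 d1 d2 nt1 h12.
have [p0 p0F] : exists p, p \in F1.
  by case: (F1) sz1 s3 => [<-//|p ? _ _]; exists p; exact: mem_head.
have hd p : p \in F1 -> head x p \in p.
  by move/(allP leg1)/take1_leg => eqp; apply: (@take1_sub G); rewrite eqp mem_head.
apply: (@dome_of_leaves [seq head x p | p <- F1] [seq behead q | q <- F2]).
- by rewrite size_map.
- by rewrite size_map.
- exact: uniq_pick d1 hd.
- rewrite pairwise_map; apply: sub_in_pairwise leg1 nt1 => p q lp lq.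
  by rewrite (take1_leg lp) (take1_leg lq) touch1 /= orbF.
- apply/allP=> _ /mapP[p /(allP leg1) lp ->].
  by case: p lp => [|a p] lp; [case/andP: lp | case/andP: (leg_head lp)].
- rewrite pairwise_map; apply: sub_pairwise d2 => p q.
  by apply: disj_sub => a; exact: mem_behead.
- move=> _ /mapP[q qF ->]; have lq := allP leg2 _ qF; split.
  + by have /andP[/and3P[_ _]] := lq; case: (q) => //= a q' /and3P[].
  + by have /andP[_] := h12 _ _ p0F qF; case: (behead q) => //; rewrite touch_sym.
  + by apply: contraNN (leg_notin lq); exact: mem_behead.
  by case: (q) lq => [|a q'] // /leg_head/andP[].
move=> _ _ /mapP[p pF ->] /mapP[q qF ->]; have /andP[/disjP dpq] := h12 _ _ pF qF.
rewrite (take1_leg (allP leg1 _ pF)) touch1 => ->; rewrite andbT.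
apply/negP=> /mem_behead; apply: dpq; exact: hd.
Qed.

Lemma touch_catr p q r : touch p (q ++ r) = touch p q || touch p r.
Proof. by rewrite ![touch p _]touch_sym /touch has_cat. Qed.

(** Three Ramsey applications: adjacent first vertices would give a clique, and first vertices
    touching the rest of later or of earlier legs give a dome. The last two are separate because
    [pairwise] compares only earlier with later entries. *)
Lemma clean_family N F : all (leg x) F -> pairwise (@disj G) F ->
  clean_number s t N <= size F ->
  has_dome \/ exists F', [/\ subseq F' F, size F' = N & pairwise (@clean G) F'].
Proof.
move=> legF dF; rewrite /clean_number; set b := biclique_number s t.
case/(ramseyP (fun p q => touch (take 1 p) (take 1 q))) => -[F1 [sF1 sz1 pw1]].
  have [noK _] := tG; case: noK.
  apply: (@contains_clique G t [seq head x p | p <- F1]); rewrite ?size_map //.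
    apply: uniq_pick (subseq_pairwise sF1 dF) _ => p /(mem_subseq sF1)/(allP legF)/take1_leg eqp.
    by apply: (@take1_sub G); rewrite eqp mem_head.
  have legF1 : all (leg x) F1 by apply/allP=> p /(mem_subseq sF1)/(allP legF).
  rewrite pairwise_map; apply: sub_in_pairwise legF1 pw1 => p q lp lq.
  by rewrite (take1_leg lp) (take1_leg lq) touch1 /= orbF.
have dirty F2 (F3 F4 : seq (seq G)) : subseq F2 F1 -> subseq F3 F2 -> subseq F4 F2 ->
    size F3 = s -> b <= size F4 ->
    {in F3 & F4, forall p q, disj p q && touch (take 1 p) (behead q)} -> has_dome.
  move=> sF2 sF3 sF4 sz3 sz4 h34.
  have sF3' := subseq_trans sF3 sF2; have sF4' := subseq_trans sF4 sF2.
  apply: dome_of_touching_heads h34 => //.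
  - by apply/allP=> p /(mem_subseq sF3')/(mem_subseq sF1)/(allP legF).
  - by apply/allP=> p /(mem_subseq sF4')/(mem_subseq sF1)/(allP legF).
  - exact: subseq_pairwise (subseq_trans sF3' sF1) dF.
  - exact: subseq_pairwise (subseq_trans sF4' sF1) dF.
  - exact: subseq_pairwise sF3' pw1.
have := leqnn (size F1); rewrite {1}sz1.
case/(ramseyP (fun p q => touch (take 1 p) (behead q))) => -[F2 [sF2 sz2 pw2]].
  left; apply: (dirty F2 (take s F2) (drop s F2)) => //.
  - exact: take_subseq.
  - exact: drop_subseq.
  - by rewrite size_take_min sz2; lia.
  - by rewrite size_drop sz2; lia.
  have := subseq_pairwise (subseq_trans sF2 sF1) dF; move: pw2.
  rewrite -{1 2}(cat_take_drop s F2) !pairwise_cat => /and3P[/allrelP h _ _] /and3P[/allrelP h' _ _].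
  by move=> p q pF qF; apply/andP; split; [exact: h' pF qF | exact: h pF qF].
have := leqnn (size F2); rewrite {1}sz2.
(* Now later first vertices touch earlier legs, so the leaves come from the end of the list. *)
case/(ramseyP (fun p q => touch (take 1 q) (behead p))) => -[F3 [sF3 sz3 pw3]].
  left; apply: (dirty F3 (drop b F3) (take b F3)) => //.
  - exact: subseq_trans sF3 sF2.
  - exact: drop_subseq.
  - exact: take_subseq.
  - by rewrite size_drop sz3; lia.
  - by rewrite size_take_min sz3; lia.
  have := subseq_pairwise (subseq_trans sF3 (subseq_trans sF2 sF1)) dF; move: pw3.
  rewrite -{1 2}(cat_take_drop b F3) !pairwise_cat => /and3P[/allrelP h _ _] /and3P[/allrelP h' _ _].
  move=> p q pF qF; apply/andP; split; last exact: h qF pF.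
  by rewrite disj_sym; exact: h' qF pF.
right; exists F3; split=> //; first exact: subseq_trans sF3 (subseq_trans sF2 sF1).
apply: pairwise_imp (subseq_pairwise (subseq_trans sF3 sF2) pw1) _ => [|/=]; last first.
  apply: (pairwise_imp (r := fun p q => ~~ touch (take 1 p) (behead q) && ~~ touch (take 1 q) (behead p))
    _ (subseq_pairwise sF3 pw2) pw3).
  by move=> p q _ _ /= -> ->.
have split1 p : p = take 1 p ++ behead p by case: p => //= a p; rewrite take0.
move=> p q _ _ /= n1 /andP[n2 n3].
have tq : touch (take 1 p) q = touch (take 1 p) (take 1 q) || touch (take 1 p) (behead q).
  by rewrite -touch_catr -split1.
have tp : touch p (take 1 q) = touch (take 1 p) (take 1 q) || touch (take 1 q) (behead p).
  by rewrite (touch_sym (take 1 p)) -touch_catr -split1 touch_sym.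
by rewrite /clean tq tp !negb_or n1 n2 n3.
Qed.

End Main.

(** * The legs of a banana *)

Section Banana.
Variables (G : sgraph) (x z : G).
Implicit Types (p : seq G) (A : {set G}) (F : seq (seq G)) (B : {set {set G}}).

(** The whole path with interior [p]: both ends are put back. *)
Definition interior_path p := [set a in x :: rcons p z].

Lemma banana_legs q B : 1 < q -> banana q x z B ->
  exists F, [/\ size F = q, all (leg x) F, {in F, forall p, z \notin p},
    uniq [seq interior_path p | p <- F] &
    {in F, forall p, interior_path p \in B}].
Proof.
move=> q1 [xz cardB pathB disjB].
have pB A : A \in B -> exists2 p, ipath (x :: rcons p z) & A = interior_path p.
  case/pathB/path_between_ipath=> p; case/lastP: p => [[_ /eqP]|p a [ip]].
    by rewrite (negbTE xz).
  by rewrite last_rcons => eaz ->; exists p; rewrite /interior_path -eaz.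
(* If [x] and [z] were adjacent, the edge would be the only induced path between them. Hence all
   interiors are nonempty and are legs. *)
have nxz : ~~ (x -- z).
  apply/negP=> xz'; have : #|B| <= 1; last by rewrite cardB leqNgt q1.
  have small A : A \in B -> A = interior_path [::].
    case/pB=> -[|a p] ip -> //; move: ip => /= /and3P[_ /andP[_ /hasPn/(_ z) h] _].
    by move: h; rewrite mem_rcons mem_head xz' => /(_ isT).
  by apply/card_le1_eqP=> A A' /small-> /small->.
have list r : {subset r <= B} -> exists F, [/\ all (leg x) F,
    {in F, forall p, z \notin p} & [seq interior_path p | p <- F] = r].
  elim: r => [|A r IH] sub; first by exists [::].
  have [|F [legF zF eqF]] := IH; first by move=> A' Ar; apply: sub; rewrite inE Ar orbT.
  have [p ip ->] := pB A (sub _ (mem_head _ _)).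
  exists (p :: F); rewrite /= eqF legF; split=> //.
    rewrite andbT; apply/andP; split.
      by move: ip; rewrite -cats1 -cat_cons => /ipath_cat[].
    by apply: contraNneq nxz => p0; move: ip; rewrite p0 /= => /and3P[_ /andP[]].
  move=> p'; rewrite inE => /predU1P[->|/zF//].
  by have := ipath_uniq ip; rewrite cons_uniq rcons_uniq => /and3P[].
have [|F [legF zF eqF]] := list (enum B); first by move=> A; rewrite mem_enum.
exists F; split=> //.
- by rewrite -cardB cardE -eqF size_map.
- by rewrite eqF enum_uniq.
by move=> p pF; rewrite -mem_enum -eqF map_f.
Qed.

Lemma interior_pathE p a : a \in p -> leg x p -> z \notin p ->
  a \in interior_path p :\: [set x; z].
Proof.
move=> ap /leg_notin xp zp; rewrite !inE mem_rcons inE ap !orbT andbT negb_or.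
by apply/andP; split; [apply: contraNneq xp | apply: contraNneq zp] => <-.
Qed.

Lemma interior_pathS p a : a \in interior_path p :\: [set x; z] -> a \in p.
Proof.
by rewrite !inE mem_rcons inE negb_or => /andP[/andP[/negbTE-> /negbTE->]].
Qed.

Lemma banana_disj q B F : banana q x z B -> all (leg x) F ->
  {in F, forall p, z \notin p} -> uniq [seq interior_path p | p <- F] ->
  {in F, forall p, interior_path p \in B} -> pairwise (@disj G) F.
Proof.
move=> [_ _ _ disjB] legF zF; rewrite uniq_pairwise pairwise_map => uF FB.
apply: (pairwise_imp _ uF uF) => p r pF rF /= ne _.
apply/disjP=> a ap ar.
have /pred0P/(_ a)/= := disjB _ _ (FB _ pF) (FB _ rF) ne.
by rewrite !interior_pathE ?zF // ?(allP legF).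
Qed.

Lemma theta_of_separated l q B F : banana q x z B -> size F = l ->
  uniq [seq interior_path p | p <- F] ->
  {in F, forall p, interior_path p \in B} -> pairwise (@separated G) F ->
  exists Q, theta l x z Q /\ cover Q \subset cover B.
Proof.
move=> [xz _ pathB disjB] szF uF FB sepF.
pose Q := [set A in [seq interior_path p | p <- F]].
have QP A : A \in Q -> exists2 p, p \in F & A = interior_path p by rewrite inE => /mapP.
have QB A : A \in Q -> A \in B by case/QP=> p /FB ? ->.
exists Q; split; last first.
  by apply/bigcupsP=> A /QB AB; exact: bigcup_sup.
split.
  split=> //; first by rewrite cardsE (card_uniqP uF) size_map.
    by move=> A /QB/pathB.
  by move=> A A' /QB AB /QB A'B; exact: disjB.
move=> A A' AQ A'Q ne; split; first exact: disjB (QB _ AQ) (QB _ A'Q) ne.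
have [[p pF eA] [p' p'F eA']] := (QP _ AQ, QP _ A'Q).
rewrite eA eA' => a b /interior_pathS ap /interior_pathS bp'.
have nep : p != p' by apply: contraNneq ne => epp; rewrite eA eA' epp.
have /andP[_] := pairwise_in (@separated_sym G) sepF pF p'F nep.
by apply: contraNN => ab; apply/touchP; exists a, b.
Qed.

End Banana.

(* A subdivided star has at least three leaves, so (s, d)-domes exist only
   for 3 <= s. *)
Theorem theorem4p1 :
  exists (f : nat -> nat -> nat -> nat) (g : nat -> nat),
    forall l s t : nat, 0 < l -> 3 <= s -> 0 < t ->
      [/\ 0 < f l s t, 0 < g t &
          forall (G : sgraph) (x z : G) (B : {set {set G}}),
            tidy t G -> banana (f l s t) x z B -> dense l x z B ->
            exists S P : {set G}, dome s (g t) S P /\ star_root S x].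
Proof.
(* The [.+2] makes [f] positive and provides the [1 < q] of [banana_legs]. *)
exists (fun l s t => (clean_number s t (ramsey (chain_number s t s.+1) l)).+2), S.
move=> l s t l0 s3 t0; split=> // G x z B tG banB denseB.
have [//|F [szF legF zF uF FB]] := banana_legs _ banB.
have dF := banana_disj banB legF zF uF FB.
case: (@clean_family G x s t s3 t0 tG (ramsey (chain_number s t s.+1) l) F legF dF) => //.
  by rewrite szF; lia.
case=> F1 [sF1 sz1 cF1]; have := leqnn (size F1); rewrite {1}sz1.
have legF1 : all (leg x) F1 by apply/allP=> p /(mem_subseq sF1)/(allP legF).
have dF1 := subseq_pairwise sF1 dF.
(* Pairwise touching legs form a good family; [l] pairwise separated ones would give an [l]-theta,
   against density. *)
case/(ramseyP (@touch G)) => -[F2 [sF2 sz2 pw2]].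
  apply: (dome_of_good s3 t0 tG (F := F2)); last by rewrite sz2.
    by apply/allP=> p /(mem_subseq sF2)/(allP legF1).
  have dcF1 : pairwise [rel p q | disj p q && clean p q] F1.
    by rewrite pairwise_relI dF1 cF1.
  apply: pairwise_imp pw2 (subseq_pairwise sF2 dcF1).
  by move=> p q _ _ tpq /andP[dpq cpq]; apply/and3P.
case: denseB; apply: (theta_of_separated (F := F2) banB) => //.
- exact: subseq_uniq (map_subseq _ (subseq_trans sF2 sF1)) uF.
- by move=> p /(mem_subseq sF2)/(mem_subseq sF1)/FB.
by apply: pairwise_imp (subseq_pairwise sF2 dF1) pw2 => p q _ _ dpq ntpq; apply/andP.
Qed.
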